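(* Let $d\ge 1$ be an integer, $\mu>-\frac12$, $\alpha=\mu+\frac{d-1}{2}$, let $n,n'\ge 0$ be integers and $N=\max\{n,n'\}$, and let $p$ be real with $p>2N+2\mu+d$. For each $m\ge 0$ let $\{P_{\mathbf k}^m:\ |\mathbf k|=m,\ \mathbf k\in\mathbb N_0^d\}$ be an orthonormal basis of $\mathcal V_m^d(\mathbb B^d,\mathsf w_\mu)$, and for $|\mathbf k|=m$, $0\le m\le n$ define $$N_{\mathbf k,n}^{(\mu,p)}(x,t)=N_{n-m}^{(p-2\alpha-2m)}(t)\;t^mP_{\mathbf k}^m\!\left(\frac xt\right).$$ Then $\{N_{\mathbf k,n}^{(\mu,p)}:\ |\mathbf k|=m,\ 0\le m\le n\}$ is an orthogonal basis of $\mathcal V_n(\mathbb V^{d+1},W_{\mu,p})$, and for $|\mathbf k|=m$, $0\le m\le n$, $|\mathbf k'|=m'$, $0\le m'\le n'$, $$\left\langle N_{\mathbf k,n}^{(\mu,p)},N_{\mathbf k',n'}^{(\mu,p)}\right\rangle_{\mu,p}=H_{m,n}^{(\mu,p)}\,\delta_{n,n'}\delta_{m,m'}\delta_{\mathbf k,\mathbf k'},\qquad H_{m,n}^{(\mu,p)}=\frac{c_{p-2\alpha}}{c_{p-2\alpha-2m}}\,h_{n-m}^{(p-2\alpha-2m)}.$$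
   Context: Univariate polynomials: $N_n^{(p)}(x)=(-1)^nx^pe^{1/x}\frac{d^n}{dx^n}\left(x^{-p+2n}e^{-1/x}\right)$, a polynomial of degree at most $n$ in $x$. Constants: $c_p=\frac1{\Gamma(p-1)}$ for $p>1$, and $h_n^{(p)}=\frac{n!\,(p-n-1)!}{(p-2n-1)\Gamma(p-1)}$, where $z!$ means $\Gamma(z+1)$. Unit ball: $\mathbb B^d=\{x\in\mathbb R^d:\|x\|\le1\}$, $\mathsf w_\mu(x)=(1-\|x\|^2)^{\mu-1/2}$, with inner product $\langle f,g\rangle_\mu=b_\mu^{\mathbb B}\int_{\mathbb B^d}fg\,\mathsf w_\mu\,dx$, $b_\mu^{\mathbb B}=\frac{\Gamma(\mu+\frac{d+1}{2})}{\pi^{d/2}\Gamma(\mu+\frac12)}$ (so $\langle1,1\rangle_\mu=1$). $\mathcal V_m^d(\mathbb B^d,\mathsf w_\mu)$ is the space of polynomials of degree at most $m$ in $d$ variables orthogonal to all polynomials of degree less than $m$; it has dimension $\binom{m+d-1}{m}$, and orthonormality is with respect to $\langle\cdot,\cdot\rangle_\mu$. For $P$ of degree at most $m$, $t^mP(x/t)$ is regarded as the corresponding homogeneous polynomial of degree $m$ in $(x,t)$. Solid cone: $\mathbb V^{d+1}=\{(x,t):\|x\|\le t,\ x\in\mathbb R^d,\ 0\le t<\infty\}$, $W_{\mu,p}(x,t)=(t^2-\|x\|^2)^{\mu-\frac12}t^{-p}e^{-1/t}$, and $\langle f,g\rangle_{\mu,p}=b_{\mu,p}^N\int_{\mathbb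 V^{d+1}}f(x,t)g(x,t)W_{\mu,p}(x,t)\,dx\,dt$ with $b_{\mu,p}^N=c_{p-2\mu-d+1}\,b_\mu^{\mathbb B}$. $\mathcal V_n(\mathbb V^{d+1},W_{\mu,p})$ is the space of polynomials of degree at most $n$ in the $d+1$ variables $(x,t)$ orthogonal, with respect to $\langle\cdot,\cdot\rangle_{\mu,p}$, to all polynomials of degree less than $n$. *)

(* Defs.v *)
From HB Require Import structures.
From mathcomp Require Import all_boot all_order all_algebra.
(* The notations of mpoly clash with those of mathcomp-analysis, which is
   loaded last so that its names take precedence. *)
From mathcomp Require Import -(notations) mpoly.
From mathcomp Require Import all_classical all_reals all_analysis.
From mathcomp Require Import zify ring lra.

Set Implicit Arguments.
Unset Strict Implicit.
Unset Printing Implicit Defensive.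
Import Order.TTheory GRing.Theory Num.Theory.
Import numFieldNormedType.Exports.
Local Open Scope classical_set_scope.
Local Open Scope ring_scope.

Section LebesgueCons.
Variable R : realType.
Local Notation M := (measurableTypeR R).

Definition cons_pair n (z : M * n.-tuple M) : n.+1.-tuple M :=
  [tuple of z.1 :: z.2].

Lemma measurable_cons_pair n : measurable_fun setT (@cons_pair n).
Proof. exact: measurable_cons. Qed.

Variables (n : nat) (m : {sigma_finite_measure set (n.-tuple M) -> \bar R}).

Definition lebesgue_cons : set (n.+1.-tuple M) -> \bar R :=
  pushforward (lebesgue_measure \x m)%E (@cons_pair n).

Let mcons := @measurable_cons_pair n.

Let lebesgue_cons0 : lebesgue_cons set0 = 0%E.
Proof. exact: measure0. Qed.

Let lebesgue_cons_ge0 A : (0 <= lebesgue_cons A)%E.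
Proof. exact: measure_ge0. Qed.

Let lebesgue_cons_sigma_additive : semi_sigma_additive lebesgue_cons.
Proof. exact: measure_semi_sigma_additive. Qed.

HB.instance Definition _ := isMeasure.Build _ _ _ lebesgue_cons
  lebesgue_cons0 lebesgue_cons_ge0 lebesgue_cons_sigma_additive.

Let lebesgue_cons_sigma_finite : sigma_finite setT lebesgue_cons.
Proof.
pose uncons (y : n.+1.-tuple M) : M * n.-tuple M := (thead y, [tuple of behead y]).
have unconsK z : uncons (cons_pair z) = z.
  by case: z => a t; rewrite /uncons /cons_pair /= theadE; congr pair; apply: val_inj.
have muncons : measurable_fun setT uncons.
  apply: measurable_fun_pair; last exact: measurable_behead.
  exact: measurable_tnth.
have /sigma_finiteP[F [FT ndF Foo]] := sigma_finiteT (@lebesgue_measure R).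
have /sigma_finiteP[G [GT ndG Goo]] := sigma_finiteT m.
exists (fun i => uncons @^-1` (F i `*` G i)).
  rewrite -preimage_bigcup -[LHS](preimage_setT uncons); congr (_ @^-1` _).
  apply/esym/seteqP; split => // -[x y] _.
  have [i _ Fx] : (\bigcup_i F i) x by rewrite -FT.
  have [j _ Gy] : (\bigcup_i G i) y by rewrite -GT.
  exists (maxn i j) => //; split => /=.
    by move: x Fx; exact/subsetPset/ndF/leq_maxl.
  by move: y Gy; exact/subsetPset/ndG/leq_maxr.
move=> i; have [mF Fi] := Foo i; have [mG Gi] := Goo i; split.
  by rewrite -[X in measurable X]setTI; apply: muncons => //; exact: measurableX.
rewrite /lebesgue_cons /pushforward -comp_preimage.
rewrite (_ : uncons \o _ = id); last exact/funext.
by rewrite preimage_id product_measure1E// lte_mul_pinfty// ge0_fin_numE.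
Qed.

HB.instance Definition _ := Measure_isSigmaFinite.Build _ _ _ lebesgue_cons
  lebesgue_cons_sigma_finite.

End LebesgueCons.

Fixpoint lebesgue_tuple (R : realType) (n : nat) :
    {sigma_finite_measure set (n.-tuple (measurableTypeR R)) -> \bar R} :=
  match n with
  | 0 => \d_ [tuple]
  | n'.+1 => lebesgue_cons (lebesgue_tuple R n')
  end.

Section Bases.
Variables (R : realType) (V : lmodType R) (ip : V -> V -> R).
Variables (I : finType) (A : {pred I}) (f : I -> V) (S : set V).

Definition is_basis : Prop :=
  [/\ forall i, i \in A -> S (f i),
      forall c : I -> R, \sum_(i in A) c i *: f i = 0 ->
        forall i, i \in A -> c i = 0
    & forall v, S v -> exists c : I -> R, v = \sum_(i in A) c i *: f i].

Definition orthogonal_basis : Prop :=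
  is_basis /\ {in A &, forall i j, i != j -> ip (f i) (f j) = 0}.

Definition orthonormal_basis : Prop :=
  is_basis /\ {in A &, forall i j, ip (f i) (f j) = (i == j)%:R}.

End Bases.

(* [msize f] is the degree of [f] plus one, and [msize 0 = 0]. *)
Definition ortho_space (R : realType) (d : nat) (ip : mpoly d R -> mpoly d R -> R)
    (m : nat) : set (mpoly d R) :=
  [set f | (msize f <= m.+1)%N /\ forall g, (msize g <= m)%N -> ip f g = 0].

Section Constants.
Variable R : realType.
Implicit Types p a : R.

Definition Gamma a : R :=
  \int[lebesgue_measure]_(x in `]0, +oo[) (x `^ (a - 1) * expR (- x)).

(* z! for a real z *)
Definition gfact a : R := Gamma (a + 1).

Definition c_const p : R := (Gamma (p - 1))^-1.

Definition h_const (n : nat) p : R :=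
  n`!%:R * gfact (p - n%:R - 1) / ((p - n.*2%:R - 1) * Gamma (p - 1)).

Definition rodrigues (n : nat) p (x : R) : R :=
  (-1) ^+ n * x `^ p * expR x^-1 *
    derive1n n (fun y => y `^ (- p + n.*2%:R) * expR (- y^-1)) x.

(* The polynomial given by the Rodrigues formula, which makes sense for
   positive x only: see [bessel_polyP] and [size_bessel_poly] below. *)
Definition bessel_poly (n : nat) p : {poly R} :=
  xget 0 [set q : {poly R} | forall x, 0 < x -> q.[x] = rodrigues n p x].

End Constants.

Section BesselPoly.
Variable R : realType.
Implicit Types (p a : R) (n : nat).

Fixpoint rodrigues_poly a n : {poly R} :=
  if n is k.+1 then
    let q := rodrigues_poly a k in
    ((a - k.*2%:R) *: 'X + 1) * q + 'X^2 * q^`()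
  else 1.

Lemma size_rodrigues_poly a n : (size (rodrigues_poly a n) <= n.+1)%N.
Proof.
elim: n => [|n IH]; first by rewrite size_poly1.
rewrite /= (leq_trans (size_polyD _ _))// geq_max; apply/andP; split.
  rewrite (leq_trans (size_polyMleq _ _))//.
  have s2 : (size ((a - n.*2%:R) *: 'X + 1 : {poly R})%R <= 2)%N.
    rewrite (leq_trans (size_polyD _ _))// geq_max size_poly1 andbT.
    by rewrite (leq_trans (size_scale_leq _ _))// size_polyX.
  by rewrite -ltnS (leq_trans (leqSpred _))//; move: (leq_add s2 IH); lia.
have [->|q0] := eqVneq (rodrigues_poly a n)^`() 0; first by rewrite mulr0 size_poly0.
rewrite mulrC size_mulXn// add2n ltnS.
have [->|r0] := eqVneq (rodrigues_poly a n) 0; first by rewrite linear0 size_poly0.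
exact: leq_trans (lt_size_deriv r0) IH.
Qed.

Lemma derive1n_rodrigues a n x : 0 < x ->
  derive1n n (fun y => y `^ a * expR (- y^-1)) x =
  x `^ (a - n.*2%:R) * expR (- x^-1) * (rodrigues_poly a n).[x].
Proof.
elim: n x => [|n IH] x x0; first by rewrite /= subr0 hornerC mulr1.
rewrite derive1nS derive1E.
set q := rodrigues_poly a n; set b := a - n.*2%:R.
pose g y := y `^ b * expR (- y^-1) * q.[y].
rewrite (@near_eq_derive _ _ _ _ g); last first.
  by near=> y; apply: IH; near: y; exact: lt_nbhsr.
have xn0 : x != 0 by rewrite gt_eqF.
have dV : is_derive x 1 (fun y : R => - y^-1) (x ^- 2).
  have := is_deriveN (@is_deriveV _ id x 1 1 xn0 (is_derive_id _ _)).
  by rewrite /GRing.scale /= mulr1 opprK.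
have dE : is_derive x 1 (fun y : R => expR (- y^-1)) (expR (- x^-1) * x ^- 2).
  by have := is_derive1_comp (is_derive_expR _) dV.
have dP := is_derive1_powR b x0.
have dq := is_derive_poly q x.
have := is_deriveM (is_deriveM dP dE) dq.
move=> /@derive_val; rewrite -/g => ->.
rewrite /= -/q !hornerE /= !fctE.
have -> : x `^ b = x `^ (a - n.+1.*2%:R) * x ^+ 2.
  rewrite -powR_mulrn ?ltW// -powRD; last by rewrite xn0 implybT.
  by congr (_ `^ _); rewrite /b doubleS -addn2 natrD; lra.
have -> : x `^ (b - 1) = x `^ (a - n.+1.*2%:R) * x.
  rewrite -[X in _ * X]powRr1 ?ltW// -powRD; last by rewrite xn0 implybT.
  by congr (_ `^ _); rewrite /b doubleS -addn2 natrD; lra.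
rewrite /GRing.scale /= -/b; field.
Unshelve. all: by end_near. Qed.

Lemma eq_poly_pos (q r : {poly R}) : (forall x, 0 < x -> q.[x] = r.[x]) -> q = r.
Proof.
move=> qr; apply/eqP; rewrite -subr_eq0; apply/negPn/negP => qr0.
pose s := [seq (i.+1)%:R : R | i <- iota 0 (size (q - r))].
have : (size s < size (q - r)%R)%N.
  apply: max_poly_roots => //.
    apply/allP => _ /mapP[i _ ->].
    by rewrite rootE hornerD hornerN qr ?subrr// ltr0n.
  rewrite map_inj_uniq ?iota_uniq// => i k /eqP.
  by rewrite eqr_nat => /eqP[].
by rewrite size_map size_iota ltnn.
Qed.

Lemma rodriguesE n p x : 0 < x ->
  rodrigues n p x = ((-1) ^+ n *: rodrigues_poly (- p + n.*2%:R) n).[x].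
Proof.
move=> x0; rewrite /rodrigues derive1n_rodrigues// addrK hornerZ.
rewrite powRN expRN; field.
by rewrite expR_eq0 gt_eqF ?powR_gt0.
Qed.

Lemma bessel_polyE n p :
  bessel_poly n p = (-1) ^+ n *: rodrigues_poly (- p + n.*2%:R) n.
Proof.
apply: eq_poly_pos => x x0; rewrite -rodriguesE//.
rewrite /bessel_poly; case: xgetP => [q _ /(_ x x0)//|].
by move=> /(_ ((-1) ^+ n *: rodrigues_poly (- p + n.*2%:R) n))[] y y0;
  rewrite rodriguesE.
Qed.

Lemma bessel_polyP n p x : 0 < x -> (bessel_poly n p).[x] = rodrigues n p x.
Proof. by move=> x0; rewrite bessel_polyE rodriguesE. Qed.

Lemma size_bessel_poly n p : (size (bessel_poly n p) <= n.+1)%N.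
Proof.
by rewrite bessel_polyE (leq_trans (size_scale_leq _ _))// size_rodrigues_poly.
Qed.

End BesselPoly.

Section Ball.
Variables (R : realType) (d : nat) (mu : R).
Local Notation M := (measurableTypeR R).

Definition enorm (x : d.-tuple R) : R := Num.sqrt (\sum_(i < d) tnth x i ^+ 2).

Definition weight_ball (x : d.-tuple R) : R :=
  (1 - enorm x ^+ 2) `^ (mu - 2^-1).

Definition b_ball : R :=
  Gamma (mu + (d%:R + 1) / 2) / (pi `^ (d%:R / 2) * Gamma (mu + 2^-1)).

Definition ip_ball (f g : mpoly d R) : R :=
  b_ball * \int[lebesgue_tuple R d]_(x in [set x : d.-tuple M | enorm x <= 1])
    (meval (tnth x) f * meval (tnth x) g * weight_ball x).

Definition V_ball (m : nat) : set (mpoly d R) := ortho_space ip_ball m.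

End Ball.

(* Polynomials in (x, t) have d + 1 variables, t being the last one. *)
Section Cone.
Variables (R : realType) (d : nat).
Local Notation M := (measurableTypeR R).

Definition cone_point (x : d.-tuple R) (t : R) : d.+1.-tuple R :=
  [tuple of rcons x t].

Definition var_t : mpoly d.+1 R := mpolyX R (mnm1 ord_max).

(* The polynomial t ^ m P(x / t), for P of degree at most m: see
   [homogenizeE] below. *)
Definition homogenize (m : nat) (P : mpoly d R) : mpoly d.+1 R :=
  \sum_(k <- msupp P) mcoeff k P *: (mwiden (mpolyX R k) * var_t ^+ (m - mdeg k)).

Lemma meval_var_t x t : meval (tnth (cone_point x t)) var_t = t.
Proof.
by rewrite mevalXU (tnth_nth t) /= nth_rcons size_tuple ltnn eqxx.
Qed.

Lemma meval_mwiden x t (q : mpoly d R) :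
  meval (tnth (cone_point x t)) (mwiden q) = meval (tnth x) q.
Proof.
rewrite /mwiden [in LHS]/mmap raddf_sum mevalE /=; apply: eq_bigr => k _.
rewrite mevalM mevalC; congr (_ * _).
rewrite /mmap1 rmorph_prod; apply: eq_bigr => i _.
rewrite /= rmorphXn /= mevalXU; congr (_ ^+ _).
by rewrite !(tnth_nth t) /= nth_rcons size_tuple ltn_ord.
Qed.

Lemma homogenizeE m P x t : (msize P <= m.+1)%N -> t != 0 ->
  meval (tnth (cone_point x t)) (homogenize m P) =
  t ^+ m * meval (fun i => tnth x i / t) P.
Proof.
move=> Pm t0; rewrite raddf_sum mevalE mulr_sumr /= !big_seq.
apply: eq_bigr => k kP.
have km : (mdeg k <= m)%N by rewrite -ltnS (leq_trans (msize_mdeg_lt kP)).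
rewrite mevalZ mevalM meval_mwiden rmorphXn /= meval_var_t mevalX.
under [in RHS]eq_bigr do rewrite exprMn.
rewrite big_split /= prodrXr -mdegE -(subnK km) exprD addnK exprVn.
field; exact: expf_neq0.
Qed.

Lemma meval_horner_alg x t (q : {poly R}) :
  meval (tnth (cone_point x t)) (horner_alg var_t q) = q.[t].
Proof.
elim/poly_ind: q => [|q c IH]; first by rewrite rmorph0 meval0 horner0.
rewrite rmorphD rmorphM /= horner_algX horner_algC mevalD mevalM IH meval_var_t.
by rewrite -mul_mpolyC mulr1 mevalC hornerMXaddC.
Qed.

Variables mu p : R.

Definition alpha : R := mu + (d%:R - 1) / 2.

Definition cone : set (d.-tuple M * M) :=
  [set z | enorm z.1 <= z.2 /\ 0 <= z.2].

Definition weight_cone (x : d.-tuple R) (t : R) : R :=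
  (t ^+ 2 - enorm x ^+ 2) `^ (mu - 2^-1) * t `^ (- p) * expR (- t^-1).

Definition b_cone : R := c_const (p - 2 * mu - d%:R + 1) * b_ball d mu.

Definition ip_cone (f g : mpoly d.+1 R) : R :=
  b_cone * \int[(lebesgue_tuple R d \x lebesgue_measure)%E]_(z in cone)
    (meval (tnth (cone_point z.1 z.2)) f * meval (tnth (cone_point z.1 z.2)) g *
     weight_cone z.1 z.2).

Definition V_cone (n : nat) : set (mpoly d.+1 R) := ortho_space ip_cone n.

(* In a family P indexed by multi-indices, P k stands for P_k^m with
   m = |k| = mdeg k. *)
Definition cone_poly (P : multinom d -> mpoly d R) (k : multinom d) (n : nat) :
    mpoly d.+1 R :=
  let m := mdeg k in
  horner_alg var_t (bessel_poly (n - m) (p - 2 * alpha - m.*2%:R)) *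
  homogenize m (P k).

Lemma cone_polyE P k n x t : (msize (P k) <= (mdeg k).+1)%N -> 0 < t ->
  meval (tnth (cone_point x t)) (cone_poly P k n) =
  rodrigues (n - mdeg k) (p - 2 * alpha - (mdeg k).*2%:R) t *
  (t ^+ mdeg k * meval (fun i => tnth x i / t) (P k)).
Proof.
move=> Pk t0; rewrite mevalM meval_horner_alg bessel_polyP// homogenizeE//.
by rewrite gt_eqF.
Qed.

Definition H_const (m n : nat) : R :=
  c_const (p - 2 * alpha) / c_const (p - 2 * alpha - m.*2%:R) *
  h_const (n - m) (p - 2 * alpha - m.*2%:R).

End Cone.

(* Main.v *)
(* Write x = t y with y in the unit ball. Then dx dt = t^d dy dt and the cone weight
   splits as t^(2 mu - 1 - p) e^(-1/t) times the ball weight at y, so an integral over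
   the cone of q(t) t^j F(x / t) is a product of a ball integral of F and a moment of q
   against t^(2 alpha + j - p) e^(-1/t), the moments of t^(-a) e^(-1/t) being values of
   Gamma. Integrating the Rodrigues formula by parts amounts, on moments, to the
   functional equation of Gamma; it makes the Bessel polynomials orthogonal and gives
   their norms. Spanning: the P_k with |k| <= m span the polynomials of degree at most m
   on the ball (by induction, removing from F its projection on lower degrees leaves an
   element of V_m), hence the N_{k,l} with l <= n span the polynomials of degree at most
   n on the cone; the coordinates with l < n of an element of V_n vanish by
   orthogonality. *)
From HB Require Import structures.
Require Import Defs.
From mathcomp Require Import all_boot all_order all_algebra.
From mathcomp Require Import -(notations) mpoly ssrcomplements.
From mathcomp Require Import all_classical all_reals all_analysis.
From mathcomp Require Import measurable_realfun.
From mathcomp Require Import zify ring lra.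

Set Implicit Arguments.
Unset Strict Implicit.
Unset Printing Implicit Defensive.
Import Order.TTheory GRing.Theory Num.Theory.
Import numFieldNormedType.Exports.
Local Open Scope classical_set_scope.
Local Open Scope ring_scope.

(** * The Gamma function *)

Section GammaTheory.
Variable R : realType.
Local Notation mu := (@lebesgue_measure R).
Implicit Types (a x u v : R) (f : R -> R).

(** The integral is a total function: a divergent integral has the value 0, so linearity and every
    identity between integrals depend on integrability. On the cone the weight decays like a power
    of [t] at infinity, and integrability is available only for polynomials of degree less than
    [p - 2 * alpha - 1]; [ip_cone] cannot be treated as bilinear on all polynomials. The integral is
    therefore traded for its linear extension from monomials ([mlin]), which is linear everywhere
    and equals the integral in the degrees that occur. The bound on [p] reads
    [2 * N + 1 < p - 2 * alpha], which is what puts the product of two polynomials of degree at most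
    N in that range. On the radial side [bessel_moment] has the same purpose: an algebraic
    functional built from values of [Gamma], for which integration by parts is checked on monomials.
    [Gamma] is itself such a total integral, so its finiteness, functional equation and positivity
    are derived from compact truncations. *)

Definition gamma_fun a x : R := x `^ (a - 1) * expR (- x).

(** The endpoints are inverse to each other, so the substitution x -> 1/x maps each interval to
    itself and one exhaustion serves both kinds of integrals. *)
Definition exhaust_itv (k : nat) : set R := `[(k.+1%:R)^-1, k.+1%:R]%classic.

Lemma measurable_exhaust_itv k : measurable (exhaust_itv k : set (measurableTypeR R)).
Proof. exact: measurable_itv. Qed.

Lemma exhaust_itv_gt0 k x : exhaust_itv k x -> 0 < x.
Proof. by rewrite /exhaust_itv /= in_itv /= => /andP[+ _]; apply: lt_le_trans. Qed.

Lemma bigcup_exhaust_itv : \bigcup_k exhaust_itv k = `]0, +oo[%classic.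
Proof.
apply/seteqP; split=> [x [k _ /exhaust_itv_gt0]|x] /=; rewrite in_itv /= andbT//.
move=> x0; pose k := Num.truncn (x + x^-1).
have xk : x + x^-1 < k.+1%:R by apply: truncnS_gt.
exists k => //; rewrite /exhaust_itv /= in_itv /=; apply/andP; split.
  rewrite invf_ple ?posrE//; apply/ltW/(le_lt_trans _ xk).
  by rewrite lerDr ltW.
by apply/ltW/(le_lt_trans _ xk); rewrite lerDl invr_ge0 ltW.
Qed.

Lemma cvg_exhaust_itv f :
  measurable_fun (`]0, +oo[%classic : set R) f -> (forall x, 0 < x -> 0 <= f x) ->
  (\int[mu]_(x in exhaust_itv k) (f x)%:E)%E @[k --> \oo] -->
  (\int[mu]_(x in `]0%R, +oo[) (f x)%:E)%E.
Proof.
move=> mf f0; rewrite -bigcup_exhaust_itv.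
apply: ge0_nondecreasing_set_cvg_integral => //.
- apply/nondecreasing_seqP => k; apply/subsetPset => x.
  rewrite /exhaust_itv /= !in_itv /= => /andP[k1 k2]; apply/andP; split.
    by apply: le_trans k1; rewrite lef_pV2 ?posrE// ler_nat.
  by apply: le_trans k2 _; rewrite ler_nat.
- move=> k; exact: measurable_exhaust_itv.
- move=> k; apply/measurable_EFinP; apply: measurable_funS mf => //.
  by move=> x /exhaust_itv_gt0; rewrite /= in_itv /= => ->.
- by move=> k x /exhaust_itv_gt0/f0; rewrite lee_fin.
Qed.

Lemma pos_continuous_measurable f : (forall x, 0 < x -> {for x, continuous f}) ->
  measurable_fun (`]0, +oo[%classic : set R) f.
Proof.
move=> cf; apply: open_continuous_measurable_fun; first exact: interval_open.
by move=> x; rewrite inE /= in_itv /= andbT => /cf.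
Qed.

Lemma pos_continuous_within f u v : (forall x, 0 < x -> {for x, continuous f}) ->
  0 < u -> {within `[u, v], continuous f}.
Proof.
move=> cf u0; apply: continuous_in_subspaceT => x.
by rewrite inE /= in_itv /= => /andP[ux _]; apply/cf/(lt_le_trans u0).
Qed.

Lemma pos_continuous_integrable f k : (forall x, 0 < x -> {for x, continuous f}) ->
  mu.-integrable (exhaust_itv k) (EFin \o f).
Proof.
move=> cf; apply: continuous_compact_integrable; first exact: segment_compact.
exact: pos_continuous_within.
Qed.

(** The boundary term x^a e^(-x) of the integration by parts is again a Gamma integrand, with
    parameter a + 1. *)
Lemma is_derive_gamma_fun a x : 0 < x ->
  is_derive x 1 (gamma_fun (a + 1)) (a * gamma_fun a x - gamma_fun (a + 1) x).
Proof.
move=> x0; have dP := is_derive1_powR (a + 1 - 1) x0.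
have dE : is_derive x 1 (fun y : R => expR (- y)) (- expR (- x)).
  have dN : is_derive x 1 (fun y : R => - y) (- 1) by exact: is_deriveN.
  by have := is_derive1_comp (is_derive_expR _) dN; rewrite mulrN1.
have := is_deriveM dP dE; rewrite /gamma_fun !addrK.
by congr (is_derive _ _ _ _); rewrite /GRing.scale /=; ring.
Qed.

Lemma gamma_fun_continuous a x : 0 < x -> {for x, continuous (gamma_fun a)}.
Proof.
move=> x0; rewrite -(subrK 1 a).
have := is_derive_gamma_fun (a - 1) x0 => /@ex_derive.
by move=> /derivable1_diffP/differentiable_continuous.
Qed.

Lemma gamma_fun_ge0 a x : 0 <= gamma_fun a x.
Proof. by rewrite mulr_ge0 ?powR_ge0 ?expR_ge0. Qed.

Definition trunc_gamma a k : R := \int[mu]_(x in exhaust_itv k) gamma_fun a x.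

Lemma gamma_fun_integrable_trunc a k :
  mu.-integrable (exhaust_itv k) (EFin \o gamma_fun a).
Proof. by apply: pos_continuous_integrable => x; apply: gamma_fun_continuous. Qed.

Lemma EFin_trunc_gamma a k :
  (trunc_gamma a k)%:E = (\int[mu]_(x in exhaust_itv k) (gamma_fun a x)%:E)%E.
Proof.
rewrite /trunc_gamma /Rintegral fineK//; apply: integrable_fin_num.
  exact: measurable_exhaust_itv.
exact: gamma_fun_integrable_trunc.
Qed.

Lemma trunc_gamma_by_parts a k :
  a * trunc_gamma a k - trunc_gamma (a + 1) k =
  gamma_fun (a + 1) k.+1%:R - gamma_fun (a + 1) (k.+1%:R)^-1.
Proof.
case: k => [|k].
  (* For k = 0 the interval is the single point 1 and both sides vanish; the fundamental theorem is
     applied between distinct endpoints. *)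
  by rewrite invr1 subrr /trunc_gamma /exhaust_itv invr1 set_itv1 !Rintegral_set1 mulr0 subr0.
have k1 : (k.+2%:R)^-1 < k.+2%:R :> R.
  by apply: (@lt_trans _ _ 1); rewrite ?invf_lt1// ltr1n.
have mE := measurable_exhaust_itv k.+1.
have iG b := gamma_fun_integrable_trunc b k.+1.
have iaG : mu.-integrable (exhaust_itv k.+1) (EFin \o (fun x => a * gamma_fun a x)).
  by have := integrableZl mE a (iG a); apply: eq_integrable.
rewrite -RintegralZl// -RintegralB//.
rewrite /Rintegral (@continuous_FTC2 _ _ (gamma_fun (a + 1)))//.
- by apply: pos_continuous_within => // x x0; apply: cvgB; [apply: cvgMr|];
    apply: gamma_fun_continuous.
- split.
  + move=> x; rewrite in_itv /= => /andP[kx _].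
    have x0 : 0 < x by apply: lt_trans kx.
    by have := is_derive_gamma_fun a x0 => /@ex_derive.
  + by apply: cvg_at_right_filter; apply: gamma_fun_continuous.
  + by apply: cvg_at_left_filter; apply: gamma_fun_continuous.
- move=> x; rewrite in_itv /= => /andP[kx _].
  have x0 : 0 < x by apply: lt_trans kx.
  by rewrite derive1E; have := is_derive_gamma_fun a x0 => /@derive_val.
Qed.

(** The extended real of which [Gamma] takes the finite part; finiteness here is what gives
    [Gamma a] its meaning. *)
Definition egamma a : \bar R := (\int[mu]_(x in `]0%R, +oo[) (gamma_fun a x)%:E)%E.

Lemma measurable_gamma_fun a : measurable_fun (`]0, +oo[%classic : set R) (gamma_fun a).
Proof. by apply: pos_continuous_measurable => x; apply: gamma_fun_continuous. Qed.

Lemma cvg_trunc_gamma_ereal a : (trunc_gamma a k)%:E @[k --> \oo] --> egamma a.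
Proof.
under eq_cvg do rewrite EFin_trunc_gamma.
by apply: cvg_exhaust_itv => [|x _]; [exact: measurable_gamma_fun|exact: gamma_fun_ge0].
Qed.

Lemma egamma_ge0 a : (0 <= egamma a)%E.
Proof. by apply: integral_ge0 => x _; rewrite lee_fin gamma_fun_ge0. Qed.

Lemma trunc_gamma_le a k : ((trunc_gamma a k)%:E <= egamma a)%E.
Proof.
rewrite EFin_trunc_gamma; apply: ge0_subset_integral => //.
- exact: measurable_exhaust_itv.
- by apply/measurable_EFinP; exact: measurable_gamma_fun.
- by move=> x _; rewrite lee_fin gamma_fun_ge0.
- by move=> x /exhaust_itv_gt0; rewrite /= in_itv /= => ->.
Qed.

Lemma egamma_lty_bound a C : (forall k, trunc_gamma a k <= C) -> (egamma a < +oo)%E.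
Proof.
move=> aC; apply: (@le_lt_trans _ _ C%:E); last exact: ltry.
rewrite -(cvg_lim _ (@cvg_trunc_gamma_ereal a))//.
apply: lime_le; first by apply/cvg_ex; exists (egamma a); exact: cvg_trunc_gamma_ereal.
by apply: nearW => k; rewrite lee_fin.
Qed.

Lemma egammaE a : (egamma a < +oo)%E -> egamma a = (Gamma a)%:E.
Proof. by move=> ay; rewrite /Gamma /Rintegral fineK// ge0_fin_numE ?egamma_ge0. Qed.

Lemma cvg_trunc_gamma a : (egamma a < +oo)%E ->
  trunc_gamma a k @[k --> \oo] --> Gamma a.
Proof.
move=> /egammaE aE; have := cvg_trunc_gamma_ereal (a := a).
by rewrite aE => /fine_cvg.
Qed.

Lemma gamma_fun_cvg0 a : 0 < a ->
  gamma_fun (a + 1) k.+1%:R - gamma_fun (a + 1) (k.+1%:R)^-1 @[k --> \oo] --> 0.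
Proof.
move=> a0; rewrite -[X in _ --> X](subrr 0).
have inv0 : (k.+1%:R)^-1 @[k --> \oo] --> (0 : R) by exact: cvg_harmonic.
apply: cvgB; last first.
  apply: (@squeeze_cvgr _ _ _ _ (cst 0) (fun k => (k.+1%:R)^-1 `^ a)).
  - apply: nearW => k; rewrite gamma_fun_ge0 /= /gamma_fun addrK.
    by rewrite ler_piMr ?powR_ge0// expR_le1 oppr_le0 invr_ge0.
  - exact: cvg_cst.
  - have := @powR_cvg0 R a a0 => /cvg_at_rightP; apply; split => //.
(* At infinity: a + 1 < m + 1, so K^a K <= K^(m+1) <= (m+1)! e^K, the last bound by one term of the
   exponential series. Hence K^a e^(-K) <= (m+1)! / K. *)
pose m := Num.truncn (a + 1).
apply: (@squeeze_cvgr _ _ _ _ (cst 0) (fun k => m.+1`!%:R * (k.+1%:R)^-1)).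
- apply: nearW => k; rewrite gamma_fun_ge0 /= /gamma_fun addrK.
  have k1 : 1 <= k.+1%:R :> R by rewrite ler1n.
  set K : R := k.+1%:R in k1 *; have K0 : 0 < K by apply: lt_le_trans k1.
  have Kn : K ^+ m.+1 <= m.+1`!%:R * expR K.
    rewrite mulrC -ler_pdivrMr ?ltr0n ?fact_gt0//.
    by apply: le_trans (expR_ge1Dxn m (ltW K0)); rewrite lerDr.
  have Ka : K `^ a * K <= K ^+ m.+1.
    have -> : K `^ a * K = K `^ (a + 1).
      by rewrite powRD ?(gt_eqF K0) ?implybT// powRr1// ltW.
    rewrite -powR_mulrn ?(ltW K0)//; apply: (ler_powR k1).
    exact/ltW/truncnS_gt.
  by rewrite ler_pdivlMr// expRN -mulrAC ler_pdivrMr ?expR_gt0// (le_trans Ka).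
- exact: cvg_cst.
- by rewrite -[X in _ --> X](mulr0 m.+1`!%:R); apply: cvgMr.
Qed.

Lemma gamma_fun1_le1 a k : 0 < a -> gamma_fun (a + 1) (k.+1%:R)^-1 <= 1.
Proof.
move=> a0; have E1 : expR (- (k.+1%:R)^-1) <= 1 :> R by rewrite expR_le1 oppr_le0 invr_ge0.
have P1 : (k.+1%:R)^-1 `^ a <= 1 :> R.
  apply: (@le_trans _ _ (1 `^ a)); last by rewrite powR1.
  by apply: ge0_ler_powR; rewrite ?nnegrE ?invr_ge0 ?(ltW a0)// invf_le1 ?ltr0n ?ler1n.
by rewrite /gamma_fun addrK mulr_ile1 ?powR_ge0 ?expR_ge0.
Qed.

Lemma egamma_nat n : (egamma n.+1%:R < +oo)%E.
Proof.
elim: n => [|n IH].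
  apply: (@egamma_lty_bound _ 1) => k.
  (* At a = 0 the formula integrates e^(-x) explicitly. *)
  have := trunc_gamma_by_parts 0 k.
  rewrite mul0r !add0r /gamma_fun subrr !powRr0 !mul1r => H.
  have E1 : expR (- (k.+1%:R)^-1) <= 1 :> R by rewrite expR_le1 oppr_le0 invr_ge0.
  have E2 : 0 <= expR (- k.+1%:R) :> R by exact: expR_ge0.
  lra.
apply: (@egamma_lty_bound _ (n.+1%:R * Gamma n.+1%:R + 1)) => k.
have := trunc_gamma_by_parts n.+1%:R k; rewrite natr1 => H.
have -> : trunc_gamma n.+2%:R k = n.+1%:R * trunc_gamma n.+1%:R k -
  gamma_fun n.+2%:R k.+1%:R + gamma_fun n.+2%:R (k.+1%:R)^-1 by lra.
apply: lerD; last by rewrite -natr1 gamma_fun1_le1.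
rewrite lerBlDr; apply: (@le_trans _ _ (n.+1%:R * Gamma n.+1%:R)).
  by rewrite ler_pM2l// -lee_fin -egammaE// trunc_gamma_le.
by rewrite lerDl gamma_fun_ge0.
Qed.

Lemma egamma_lty_ge1 a : 1 <= a -> (egamma a < +oo)%E.
Proof.
move=> a1; pose n := Num.truncn a.
(* Since a < n + 1, x^(a-1) is at most 1 for x <= 1 and at most x^n for x > 1, so the two integer
   cases dominate. *)
apply: (@le_lt_trans _ _ (egamma 1 + egamma n.+1%:R)%E); last first.
  by apply: lte_add_pinfty; [exact: (egamma_nat 0)|exact: (egamma_nat n)].
have mE b : measurable_fun (`]0, +oo[%classic : set R) (EFin \o gamma_fun b).
  by apply/measurable_EFinP; exact: measurable_gamma_fun.
rewrite /egamma -ge0_integralD//=; last 4 first.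
- by move=> x _; rewrite lee_fin gamma_fun_ge0.
- exact: mE.
- by move=> x _; rewrite lee_fin gamma_fun_ge0.
- exact: mE.
apply: ge0_le_integral => //=.
- by move=> x _; rewrite lee_fin gamma_fun_ge0.
- exact: mE.
- by apply: emeasurable_funD; exact: mE.
move=> x; rewrite in_itv /= andbT => x0.
rewrite -EFinD lee_fin /gamma_fun -mulrDl ler_pM2r ?expR_gt0//.
rewrite subrr powRr0; have [x1|x1] := leP x 1.
  apply: (@le_trans _ _ 1); last by rewrite lerDl powR_ge0.
  apply: (@le_trans _ _ (1 `^ (a - 1))); last by rewrite powR1.
  by apply: ge0_ler_powR; rewrite ?nnegrE ?subr_ge0 ?(ltW x0).
apply: (@le_trans _ _ (x `^ (n.+1%:R - 1))); last by rewrite lerDr.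
by apply: ler_powR; rewrite ?(ltW x1)// lerD2r; apply/ltW/truncnS_gt.
Qed.

(** Integration by parts goes down from a + 1 to a: a times the truncation is at most
    [Gamma (a + 1)] plus the boundary terms, which are bounded because they converge. *)
Lemma egamma_lty a : 0 < a -> (egamma a < +oo)%E.
Proof.
move=> a0; have a1 : (egamma (a + 1) < +oo)%E by rewrite egamma_lty_ge1// lerDr ltW.
have [C [_ HC]] := cvg_seq_bounded (cvgP _ (gamma_fun_cvg0 a0)).
(* Boundedness is available for every constant strictly above C; [|C| + 1] is one. *)
pose B := a^-1 * (Gamma (a + 1) + (`|C| + 1)).
apply: (@egamma_lty_bound _ B) => k.
rewrite /B ler_pdivlMl//; have := trunc_gamma_by_parts a k => /eqP.
rewrite subr_eq addrC => /eqP ->; apply: lerD.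
  by rewrite -lee_fin -egammaE// trunc_gamma_le.
apply: le_trans (ler_norm _) _.
apply: (HC (`|C| + 1)) => //.
by rewrite (le_lt_trans (ler_norm C))// ltrDl.
Qed.

Lemma GammaS a : 0 < a -> Gamma (a + 1) = a * Gamma a.
Proof.
move=> a0; have ay := egamma_lty a0.
have aSy : (egamma (a + 1) < +oo)%E by rewrite egamma_lty// addr_gt0.
have c1 : a * trunc_gamma a k - trunc_gamma (a + 1) k @[k --> \oo] -->
    a * Gamma a - Gamma (a + 1).
  by apply: cvgB; [apply: cvgMr|]; exact: cvg_trunc_gamma.
have := gamma_fun_cvg0 a0.
under eq_cvg do rewrite -trunc_gamma_by_parts.
move=> c0; apply/esym/eqP; rewrite -subr_eq0; apply/eqP.
exact: (cvg_unique _ c1 c0).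
Qed.

Lemma Gamma_gt0 a : 0 < a -> 0 < Gamma a.
Proof.
move=> a0; rewrite -lte_fin -egammaE ?egamma_lty//.
(* On [1, 2], 0 <= ln x <= 2, so x^(a-1) = e^((a-1) ln x) >= e^(-2|a-1|), and e^(-x) >= e^(-2). *)
pose c := expR (- (`|a - 1| * 2) - 2).
apply: (@lt_le_trans _ _ (\int[mu]_(x in `[1%R, 2%R]) c%:E)%E).
  rewrite integral_cst//= lebesgue_measure_itv /= lte_fin ltr1n -EFinD -EFinM lte_fin.
  by rewrite mulr_gt0 ?expR_gt0// subr_gt0 ltr1n.
apply: (@le_trans _ _ (\int[mu]_(x in `[1%R, 2%R]) (gamma_fun a x)%:E)%E).
  apply: ge0_le_integral => //=.
  - by move=> x _; rewrite lee_fin expR_ge0.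
  - by apply/measurable_EFinP; apply: measurable_funS (measurable_gamma_fun a) => //;
      move=> x /=; rewrite !in_itv /= => /andP[x1 _]; rewrite andbT (lt_le_trans _ x1).
  move=> x; rewrite in_itv /= => /andP[x1 x2]; rewrite lee_fin /c /gamma_fun.
  have x0 : 0 < x by rewrite (lt_le_trans _ x1).
  rewrite expRD /powR gt_eqF// ler_pM ?expR_ge0// ler_expR ?lerN2//.
  rewrite lerNl; apply: le_trans (ler_norm _) _; rewrite normrN normrM.
  rewrite ler_wpM2l// ger0_norm ?ln_ge0//.
  by apply: le_trans x2; apply/ltW/ln_sublinear.
apply: ge0_subset_integral => //=.
- by apply/measurable_EFinP; exact: measurable_gamma_fun.
- by move=> x _; rewrite lee_fin gamma_fun_ge0.
- by move=> x /=; rewrite !in_itv /= => /andP[x1 _]; rewrite andbT (lt_le_trans _ x1).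
Qed.


End GammaTheory.

(** * The substitution x -> 1/x and the integrals of x^(-a) e^(-1/x) *)

Section InvGamma.
Variable R : realType.
Local Notation mu := (@lebesgue_measure R).
Implicit Types (a x u v : R) (f : R -> R).

Definition inv_gamma_fun a x : R := x `^ (- a) * expR (- x^-1).

Lemma is_derive_inv x : 0 < x -> is_derive x 1 (fun y : R => y^-1) (- x ^- 2).
Proof.
move=> x0; have xn0 : x != 0 by rewrite gt_eqF.
have := @is_deriveV _ id x 1 1 xn0 (is_derive_id _ _).
by rewrite /GRing.scale /= mulr1.
Qed.

Lemma inv_continuous_pos x : 0 < x -> {for x, continuous (fun y : R => y^-1)}.
Proof. by move=> x0; apply: inv_continuous; rewrite gt_eqF. Qed.

Lemma inv_gamma_fun_continuous a x : 0 < x -> {for x, continuous (inv_gamma_fun a)}.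
Proof.
move=> x0; apply: continuousM.
  apply/differentiable_continuous/derivable1_diffP.
  by apply: derivable_powR; rewrite in_itv /= x0.
apply: continuous_comp; last exact: continuous_expR.
by apply: continuousN; exact: inv_continuous_pos.
Qed.

Lemma inv_gamma_fun_ge0 a x : 0 <= inv_gamma_fun a x.
Proof. by rewrite mulr_ge0 ?powR_ge0 ?expR_ge0. Qed.

Lemma measurable_inv_gamma_fun a :
  measurable_fun (`]0, +oo[%classic : set R) (inv_gamma_fun a).
Proof. by apply: pos_continuous_measurable => x; apply: inv_gamma_fun_continuous. Qed.

(** With y = 1/x the integrand y^(a-2) e^(-y) acquires the Jacobian x^(-2), and x^(2-a) x^(-2) =
    x^(-a). *)
Lemma trunc_inv_gamma a k :
  (\int[mu]_(x in @exhaust_itv R k) (inv_gamma_fun a x)%:E =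
   \int[mu]_(x in @exhaust_itv R k) (gamma_fun (a - 1) x)%:E)%E.
Proof.
pose K : R := k.+1%:R; have K0 : 0 < K by rewrite ltr0n.
have Ki0 : 0 < K^-1 by rewrite invr_gt0.
have dI x : 0 < x -> derive1 (fun y : R => y^-1) x = - x ^- 2.
  by move=> x0; rewrite derive1E; have := is_derive_inv x0 => /@derive_val.
have cI x : 0 < x -> {for x, continuous (derive1 (fun y : R => y^-1))}.
  move=> x0; rewrite /prop_for /continuous_at dI//.
  have : (fun y : R => - y ^- 2) y @[y --> x] --> - x ^- 2.
    apply: cvgN; apply: cvgV; first by rewrite expf_neq0 // gt_eqF.
    exact: exprn_continuous.
  apply: cvg_trans; apply: near_eq_cvg; near=> y.
  by rewrite dI//; near: y; exact: lt_nbhsr.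
have := @integration_by_substitution_decreasing R (fun y => y^-1) (gamma_fun (a - 1)) K^-1 K.
rewrite /= invrK /exhaust_itv -/K => ->.
- apply: eq_integral => x; rewrite inE /= in_itv /= => /andP[x1 _]; congr (_ %:E).
  have x0 : 0 < x by rewrite (lt_le_trans _ x1).
  rewrite [RHS](_ : _ = gamma_fun (a - 1) x^-1 * - derive1 (fun y : R => y^-1) x)//.
  rewrite dI// opprK /inv_gamma_fun /gamma_fun mulrAC; congr (_ * _).
  rewrite -[x ^- 2]powR_invn ?(ltW x0)// -[x^-1]powR_inv1 ?(ltW x0)//.
  by rewrite -powRrM -powRD ?(gt_eqF x0) ?implybT//; congr (_ `^ _); lra.
- apply: (@le_trans _ _ 1); first by rewrite invf_le1// ler1n.
  by rewrite ler1n.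
- move=> x y; rewrite !in_itv /= => /andP[x1 _] /andP[y1 _] xy.
  by rewrite ltf_pV2 ?posrE ?(lt_le_trans Ki0).
- by move=> x; rewrite in_itv /= => /andP[x1 _]; apply/cI/(lt_trans Ki0).
- by apply: cvgP; apply: cvg_at_right_filter; exact: cI.
- by apply: cvgP; apply: cvg_at_left_filter; exact: cI.
- split.
  + move=> x; rewrite in_itv /= => /andP[x1 _].
    by have := is_derive_inv (lt_trans Ki0 x1) => /@ex_derive.
  + by apply: cvg_at_right_filter; exact: inv_continuous_pos.
  + by apply: cvg_at_left_filter; exact: inv_continuous_pos.
- by apply: pos_continuous_within => // x; exact: gamma_fun_continuous.
Unshelve. all: by end_near. Qed.

Lemma integral_inv_gamma_fun a : 1 < a ->
  (\int[mu]_(x in `]0%R, +oo[) (inv_gamma_fun a x)%:E = (Gamma (a - 1))%:E)%E.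
Proof.
move=> a1; rewrite -egammaE; last by rewrite egamma_lty// subr_gt0.
have c1 := cvg_exhaust_itv (measurable_inv_gamma_fun a) (fun x _ => inv_gamma_fun_ge0 a x).
have c2 := cvg_exhaust_itv (measurable_gamma_fun (a - 1)) (fun x _ => gamma_fun_ge0 (a - 1) x).
move: c1; under eq_cvg do rewrite trunc_inv_gamma.
by move=> c1; exact: (cvg_unique _ c1 c2).
Qed.

End InvGamma.

(** * Dilations of Lebesgue measure and integration over the cone *)

Section Dilation.
Variable R : realType.
Local Notation M := (measurableTypeR R).
Local Notation mu := (@lebesgue_measure R).
Local Open Scope ereal_scope.
Import HBNNSimple.

Lemma measurable_divr (t : R) : measurable_fun setT ((fun x => x / t)%R : M -> M).
Proof. by apply: measurable_funM. Qed.

Lemma ge0_integral_dilation1 (t : R) (f : M -> \bar R) : (0 < t)%R ->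
  measurable_fun setT f -> (forall x, 0 <= f x) ->
  \int[mu]_x f (x / t)%R = t%:E * \int[mu]_x f x.
Proof.
move=> t0 mf f0; have ti0 : (0 <= t^-1)%R by rewrite invr_ge0 ltW.
pose phi : M -> M := fun x => (x / t)%R; have mphi := measurable_divr t.
pose pushM : {measure set M -> \bar R} := pushforward mu phi.
(* The image of Lebesgue measure under x -> x / t, scaled by 1/t, has the right value on intervals,
   hence is Lebesgue measure by uniqueness. *)
pose nu : {measure set M -> \bar R} := mscale (NngNum ti0) (pushM mphi).
have nuE A : measurable A -> mu A = nu A.
  apply: lebesgue_measure_unique => /= _ [[a b] _ <-].
  rewrite /nu /mscale /= /pushforward.
  rewrite (_ : _ @^-1` _ = `]a * t, b * t]%classic)%R; last first.
    by apply/seteqP; split=> x /=; rewrite !in_itv /= ltr_pdivlMr// ler_pdivrMr.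
  rewrite !lebesgue_measure_itv /= !lte_fin ltr_pM2r//.
  case: ifPn => _; last by rewrite mule0.
  by rewrite -!EFinB -EFinM -mulrBl mulrCA mulVf ?mulr1// gt_eqF.
rewrite -[in RHS](@eq_measure_integral _ _ _ setT mu nu) => [|A mA _]; last exact/esym/nuE.
rewrite ge0_integral_mscale//= ge0_integral_pushforward//=.
by rewrite preimage_setT muleA -EFinM divff ?gt_eqF// mul1e.
Qed.

Definition dilation n (t : R) (x : n.-tuple R) : n.-tuple R :=
  [tuple tnth x i / t | i < n]%R.

Lemma measurable_dilation n t :
  measurable_fun setT (@dilation n t : n.-tuple M -> n.-tuple M).
Proof.
apply/measurable_fun_tnthP => i.
apply: (eq_measurable_fun (fun x : n.-tuple M => tnth x i / t)%R).
  by move=> x _ /=; rewrite tnth_mktuple.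
by apply: measurable_funM => //; exact: measurable_tnth.
Qed.

Lemma ge0_integral_lebesgue_cons n (f : n.+1.-tuple M -> \bar R) :
  measurable_fun setT f -> (forall x, 0 <= f x) ->
  \int[lebesgue_tuple R n.+1]_x f x =
  \int[mu]_a \int[lebesgue_tuple R n]_x f (cons_pair (a, x)).
Proof.
move=> mf f0; rewrite /= ge0_integral_pushforward//; last exact: measurable_cons_pair.
rewrite preimage_setT fubini_tonelli1//=.
by apply: measurableT_comp => //; exact: measurable_cons_pair.
Qed.

Lemma ge0_integral_dilation n (t : R) (f : n.-tuple M -> \bar R) : (0 < t)%R ->
  measurable_fun setT f -> (forall x, 0 <= f x) ->
  \int[lebesgue_tuple R n]_x f (dilation t x) =
  (t ^+ n)%:E * \int[lebesgue_tuple R n]_x f x.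
Proof.
move=> t0; elim: n f => [|n IH] f mf f0.
  rewrite expr0 mul1e; apply: eq_integral => x _; congr (f _).
  by rewrite (tuple0 x); apply: eq_from_tnth => -[].
rewrite [LHS]ge0_integral_lebesgue_cons//; last first.
  by apply: measurableT_comp => //; exact: measurable_dilation.
rewrite ge0_integral_lebesgue_cons//.
have mfc : measurable_fun setT (f \o @cons_pair R n).
  by apply: measurableT_comp => //; exact: measurable_cons_pair.
(* The induction hypothesis dilates the last n coordinates under the outer integral; the
   one-dimensional case then dilates the first. *)
transitivity (\int[mu]_a ((t ^+ n)%:E *
    \int[lebesgue_tuple R n]_x f (cons_pair ((a / t)%R, x)))).
  apply: eq_integral => a _; rewrite -IH//; last first.
    exact: (measurableT_comp mfc (pair1_measurable _)).
  apply: eq_integral => x _; congr (f _).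
  by apply: eq_from_tnth => i; rewrite tnth_mktuple; case: (unliftP ord0 i) => [j ->|->];
    rewrite ?tnthS ?tnth0 ?tnth_mktuple.
have mF := measurable_fun_fubini_tonelli_F (m2 := lebesgue_tuple R n)
  (f \o @cons_pair R n) mfc (fun x => f0 _).
rewrite ge0_integralZl//; last 3 first.
- by apply: (measurableT_comp mF); exact: measurable_divr.
- by move=> a _; apply: integral_ge0.
- by rewrite lee_fin exprn_ge0// ltW.
rewrite exprSr EFinM -muleA; congr (_ * _).
have F0 (a : M) : 0 <= fubini_F (lebesgue_tuple R n) (f \o @cons_pair R n) a.
  by apply: integral_ge0 => x _; exact: f0.
exact: (ge0_integral_dilation1 t0 mF F0).
Qed.

End Dilation.

(** * Cone integrals in the coordinates (x / t, t) *)

Section ConeIntegral.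
Variables (R : realType) (d : nat).
Local Notation M := (measurableTypeR R).
Local Notation lam := (@lebesgue_measure R).
Local Notation lamd := (lebesgue_tuple R d).

Definition ball1 : set (d.-tuple M) := [set x : d.-tuple M | enorm x <= 1].

Lemma measurable_enorm : measurable_fun setT (@enorm R d : d.-tuple M -> R).
Proof.
apply: (@measurableT_comp _ _ _ _ _ _ (@Num.sqrt R)).
  by apply: continuous_measurable_fun; exact: sqrt_continuous.
apply: measurable_sum => i; apply: measurable_funX; exact: measurable_tnth.
Qed.

Lemma enorm_ge0 (x : d.-tuple R) : 0 <= enorm x.
Proof. exact: sqrtr_ge0. Qed.

Lemma measurable_ball1 : measurable ball1.
Proof.
rewrite -[ball1]setTI.
have := measurable_fun_ler measurable_enorm (measurable_cst (1 : R)).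
move=> /(_ measurableT [set true] I); congr (measurable (_ `&` _)).
Qed.

Lemma measurable_cone : measurable (@Defs.cone R d).
Proof.
have m1 : measurable_fun setT (fun z : d.-tuple M * M => enorm z.1).
  by apply: (measurableT_comp measurable_enorm); exact: measurable_fst.
have m2 : measurable_fun setT (fun z : d.-tuple M * M => (z.2 : R)) by exact: measurable_snd.
rewrite (_ : @Defs.cone R d =
  (setT `&` (fun z : d.-tuple M * M => enorm z.1 <= z.2 :> R) @^-1` [set true]) `&`
  (setT `&` (fun z : d.-tuple M * M => 0 <= z.2 :> R) @^-1` [set true])).
  apply: measurableI.
  - by apply: (measurable_fun_ler m1 m2).
  - by apply: (measurable_fun_ler (measurable_cst (0 : R)) m2).
by apply/seteqP; split=> [z [z1 z2]|z [[_ z1] [_ z2]]].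
Qed.

Lemma measurable_weight_ball (mu : R) :
  measurable_fun setT (weight_ball mu : d.-tuple M -> R).
Proof.
apply: (measurableT_comp (measurable_powR _)).
by apply: measurable_funB => //; apply: measurable_funX; exact: measurable_enorm.
Qed.

Lemma enorm_dilation (t : R) (x : d.-tuple R) : 0 < t ->
  enorm (dilation t x) = enorm x / t.
Proof.
move=> t0; rewrite /enorm.
under eq_bigr do rewrite tnth_mktuple exprMn.
rewrite -mulr_suml sqrtrM; last by apply: sumr_ge0 => i _; exact: sqr_ge0.
by rewrite sqrtr_sqr ger0_norm// invr_ge0 ltW.
Qed.

Lemma weight_cone_dilation (mu p t : R) (x : d.-tuple R) : 0 < t -> enorm x <= t ->
  weight_cone mu p x t =
  weight_ball mu (dilation t x) * inv_gamma_fun (p - 2 * mu + 1) t.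
Proof.
move=> t0 xt; rewrite /weight_cone /weight_ball /inv_gamma_fun enorm_dilation//.
have -> : t ^+ 2 - enorm x ^+ 2 = (1 - (enorm x / t) ^+ 2) * t ^+ 2.
  by field; rewrite gt_eqF.
(* A real power of a product splits for nonnegative factors; [enorm x <= t] provides the sign of 1 -
   |x/t|^2. *)
rewrite powRM ?sqr_ge0//; last first.
  rewrite subr_ge0 exprn_ile1// ?ler_pdivrMr ?mul1r//.
  by rewrite divr_ge0 ?enorm_ge0 ?ltW.
rewrite -!mulrA; congr (_ * _); rewrite mulrA; congr (_ * _).
rewrite -[t ^+ 2]powR_mulrn ?(ltW t0)// -powRrM -powRD ?(gt_eqF t0) ?implybT//.
by congr (_ `^ _); lra.
Qed.

Section Separated.
Variables (Psi : d.-tuple M -> R) (a : R).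
Hypothesis iPsi : lamd.-integrable setT (EFin \o Psi).

Let mPsi : measurable_fun setT Psi.
Proof. by apply/measurable_EFinP; exact: measurable_int iPsi. Qed.

Lemma integral_dilation (t : R) : 0 < t ->
  (\int[lamd]_x (Psi (dilation t x))%:E = (t ^+ d)%:E * \int[lamd]_x (Psi x)%:E)%E.
Proof.
move=> t0; rewrite integralE [in RHS]integralE.
have mE := measurable_int _ iPsi.
transitivity ((t ^+ d)%:E * (\int[lamd]_x (EFin \o Psi)^\+ x) -
    (t ^+ d)%:E * (\int[lamd]_x (EFin \o Psi)^\- x))%E.
  rewrite -(ge0_integral_dilation t0 (measurable_funepos mE) (funepos_ge0 _)).
  rewrite -(ge0_integral_dilation t0 (measurable_funeneg mE) (funeneg_ge0 _)).
  by congr (_ - _)%E; apply: eq_integral => x _; rewrite ?funeposE ?funenegE.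
rewrite -muleBr//.
apply: fin_num_adde_defl.
by rewrite fin_numN; exact: integrable_neg_fin_num.
Qed.

(** Extension by 0 to the whole line turns cone integrals into integrals over the full product
    space, ready for Fubini. *)
Definition radial (t : R) : R := (inv_gamma_fun a \_ `]0, +oo[) t.

Lemma radialE t : radial t = if 0 < t then inv_gamma_fun a t else 0.
Proof. by rewrite /radial patchE mem_setE in_itv /= andbT. Qed.

Lemma measurable_radial : measurable_fun (setT : set M) (radial : M -> R).
Proof.
have /(measurable_restrictT (inv_gamma_fun a)) : measurable (`]0, +oo[%classic : set M) by [].
by case=> + _; apply; exact: (measurable_inv_gamma_fun a).
Qed.

Definition separated (z : d.-tuple M * M) : R := Psi (dilation z.2 z.1) * radial z.2.

Lemma measurable_separated : measurable_fun setT separated.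
Proof.
(* The quotient x / t is rewritten with a real power of t, which is measurable on the whole line;
   the two agree for t > 0, and [radial] vanishes for t <= 0. *)
pose D (z : d.-tuple M * M) : d.-tuple M := [tuple tnth z.1 i * z.2 `^ (-1) | i < d].
apply: (eq_measurable_fun (fun z => Psi (D z) * radial z.2)) => [z _|].
  rewrite /separated radialE; case: ifPn => [z0|_]; last by rewrite !mulr0.
  by congr (Psi _ * _); apply: eq_from_tnth => i; rewrite !tnth_mktuple powR_inv1// ltW.
apply: measurable_funM.
  apply: (measurableT_comp mPsi); apply/measurable_fun_tnthP => i.
  apply: (eq_measurable_fun (fun z : d.-tuple M * M => tnth z.1 i * z.2 `^ (-1))).
    by move=> z _ /=; rewrite tnth_mktuple.
  apply: measurable_funM.
    by apply: (measurableT_comp (measurable_tnth i)); exact: measurable_fst.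
  by apply: (measurableT_comp (measurable_powR _)); exact: measurable_snd.
by apply: (measurableT_comp measurable_radial); exact: measurable_snd.
Qed.

End Separated.

Lemma integral_separated_slice (Psi : d.-tuple M -> R) a (t : R) :
  lamd.-integrable setT (EFin \o Psi) ->
  (\int[lamd]_x (separated Psi a (x, t))%:E =
   (radial (a - d%:R) t)%:E * \int[lamd]_x (Psi x)%:E)%E.
Proof.
move=> iPsi; rewrite /separated /= !radialE; case: ifPn => t0; last first.
  by rewrite mul0e; under eq_integral do rewrite mulr0; rewrite integral0.
have mD : measurable_fun setT (fun x : d.-tuple M => (Psi (dilation t x))%:E).
  apply/measurable_EFinP; apply: (measurableT_comp (f := Psi)).
    by apply/measurable_EFinP; exact: measurable_int iPsi.
  exact: measurable_dilation.
under eq_integral do rewrite EFinM.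
rewrite integralZr//=; last first.
  apply/integrableP; split=> //.
  have iA := integrable_abse iPsi.
  rewrite (_ : (\int[_]__ _)%E = (t ^+ d)%:E * \int[lamd]_x `|Psi x|%:E)%E.
    apply: lte_mul_pinfty => //; first by rewrite lee_fin exprn_ge0// ltW.
    by case/integrableP : iPsi.
  by rewrite -(integral_dilation (Psi := fun x => `|Psi x|)).
rewrite integral_dilation// muleAC -EFinM; congr (_%:E * _)%E.
rewrite /inv_gamma_fun mulrA; congr (_ * _).
rewrite -powR_mulrn ?(ltW t0)// -powRD ?(gt_eqF t0) ?implybT//.
by congr (_ `^ _); lra.
Qed.

Lemma radial_integral a : 1 < a ->
  (\int[lam]_t (radial a t)%:E = (Gamma (a - 1))%:E)%E.
Proof.
move=> a1; rewrite -integral_inv_gamma_fun// [RHS]integral_mkcond.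
by apply: eq_integral => t _; rewrite /radial restrict_EFin.
Qed.

Lemma radial_ge0 a t : 0 <= radial a t.
Proof. by rewrite radialE; case: ifPn => // _; exact: inv_gamma_fun_ge0. Qed.

Lemma radial_integrable a : 1 < a -> lam.-integrable setT (EFin \o radial a).
Proof.
move=> a1; apply/integrableP; split.
  by apply/measurable_EFinP; exact: measurable_radial.
under eq_integral do rewrite /= ger0_norm ?radial_ge0//.
by rewrite radial_integral// ltry.
Qed.

Lemma integral_separated (Psi : d.-tuple M -> R) a :
  lamd.-integrable setT (EFin \o Psi) -> 1 < a - d%:R ->
  (lamd \x lam)%E.-integrable setT (EFin \o separated Psi a) /\
  (\int[(lamd \x lam)%E]_z (separated Psi a z)%:E =
   (Gamma (a - d%:R - 1) * \int[lamd]_x Psi x)%:E)%E.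
Proof.
move=> iPsi a1.
have EPsi : (\int[lamd]_x (Psi x)%:E = (\int[lamd]_x Psi x)%:E)%E.
  by rewrite /Rintegral fineK//; exact: integrable_fin_num.
have iA : lamd.-integrable setT (EFin \o (fun x => `|Psi x|)).
  exact: integrable_norm.
have mS : measurable_fun setT (EFin \o separated Psi a).
  by apply/measurable_EFinP; exact: measurable_separated.
have iS : (lamd \x lam)%E.-integrable setT (EFin \o separated Psi a).
  (* The absolute value is again [separated], for [|Psi|], so the slice formula also computes the
     integral that has to be finite. *)
  apply/integrable21ltyP => //=.
  under eq_integral => t _.
    under eq_integral => x _.
      rewrite normrM (ger0_norm (radial_ge0 _ _)).
      rewrite -[X in X%:E]/(separated (fun x => `|Psi x|) a (x, t)).
    over.
    rewrite integral_separated_slice//.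
  over.
  have EA : (\int[lamd]_x `|Psi x|%:E = (\int[lamd]_x `|Psi x|)%:E)%E.
    by rewrite /Rintegral fineK//; exact: integrable_fin_num.
  rewrite EA integralZr//; last exact: radial_integrable.
  by rewrite radial_integral// -EFinM ltry.
split=> //; rewrite -integral21_prod_meas1//= /fubini_G.
under eq_integral do rewrite integral_separated_slice// EPsi.
by rewrite integralZr//; [rewrite radial_integral|exact: radial_integrable].
Qed.

Lemma cone_integral (mu p : R) (j : nat) (Phi : d.-tuple M -> R)
    (f : d.-tuple M * M -> R) : p != 0 -> 1 < p - 2 * alpha d mu - j%:R ->
  (forall x t, 0 < t -> f (x, t) = t ^+ j * Phi (dilation t x)) ->
  lamd.-integrable ball1 (EFin \o (fun x => Phi x * weight_ball mu x)) ->
  (lamd \x lam)%E.-integrable (@Defs.cone R d)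
    (EFin \o (fun z => f z * weight_cone mu p z.1 z.2)) /\
  \int[(lamd \x lam)%E]_(z in @Defs.cone R d) (f z * weight_cone mu p z.1 z.2) =
  Gamma (p - 2 * alpha d mu - j%:R - 1) *
  \int[lamd]_(x in ball1) (Phi x * weight_ball mu x).
Proof.
move=> p0 pj fE iPhi; pose Psi := (fun x => Phi x * weight_ball mu x) \_ ball1.
have iPsi : lamd.-integrable setT (EFin \o Psi).
  have := iPhi => /(integrable_mkcond _ measurable_ball1).
  by apply: eq_integrable => // x _; rewrite /= restrict_EFin.
(* The exponent p - 2 mu + 1 of the weight, lowered by j by the factor t^j; the Jacobian t^d lowers
   it further to p - 2 alpha - j. *)
pose a := p - 2 * mu + 1 - j%:R.
have aE : a - d%:R = p - 2 * alpha d mu - j%:R by rewrite /a /alpha; lra.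
have sE : (fun z => f z * weight_cone mu p z.1 z.2) \_ (@Defs.cone R d) = separated Psi a.
  apply/funext => -[x t]; rewrite /separated radialE /= patchE.
  case: ifPn => [|zC].
    rewrite inE => -[/= xt]; rewrite le_eqVlt => /predU1P[t0|t0].
      (* At the apex the weight must vanish like [radial]: 0 to the power -p is 0 because p is
         nonzero, whereas 0 to the power 0 is 1. *)
      by rewrite -t0 ltxx mulr0 /weight_cone powR0 ?oppr_eq0// !(mulr0, mul0r).
    rewrite t0 fE// weight_cone_dilation// /Psi patchE mem_set; last first.
      by rewrite /ball1 /= enorm_dilation// ler_pdivrMr// mul1r.
    have -> : inv_gamma_fun a t = t ^+ j * inv_gamma_fun (p - 2 * mu + 1) t.
      rewrite /inv_gamma_fun mulrA; congr (_ * _).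
      rewrite -powR_mulrn ?(ltW t0)// -powRD ?(gt_eqF t0) ?implybT//.
      by congr (_ `^ _); rewrite /a; lra.
    ring.
  case: ifPn => t0; last by rewrite mulr0.
  rewrite /Psi patchE memNset ?mul0r// /ball1 /= enorm_dilation// ler_pdivrMr// mul1r.
  by move=> xt; move: zC; rewrite notin_setE; apply; split=> //=; exact: ltW.
have a1 : 1 < a - d%:R by rewrite aE.
have [iS vS] := integral_separated iPsi a1.
rewrite aE in vS; split.
  apply/(integrable_mkcond _ measurable_cone).
  by apply: eq_integrable iS => // z _; rewrite /= -sE restrict_EFin.
rewrite [LHS]Rintegral_mkcond sE [in RHS]Rintegral_mkcond -/Psi.
by rewrite /Rintegral vS.
Qed.

End ConeIntegral.

(** * Moments of the Bessel polynomials *)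

Section BesselMoments.
Variable R : realType.
Implicit Types (a b p : R) (q r : {poly R}).

Lemma Gamma_prod a n : 0 < a ->
  Gamma (a + n%:R) = \prod_(k < n) (a + k%:R) * Gamma a.
Proof.
move=> a0; elim: n => [|n IH]; first by rewrite addr0 big_ord0 mul1r.
rewrite -natr1 addrA GammaS ?IH ?big_ord_recr /=; first by ring.
by rewrite ltr_wpDr.
Qed.

(* The integral of q(t) t^(-a) e^(-1/t) over t > 0, when it converges. *)
Definition bessel_moment a q : R := \sum_(i < size q) q`_i * Gamma (a - i%:R - 1).

Lemma bessel_moment_widen a q n : (size q <= n)%N ->
  bessel_moment a q = \sum_(i < n) q`_i * Gamma (a - i%:R - 1).
Proof.
move=> qn; rewrite /bessel_moment.
rewrite (big_ord_widen n (fun i => q`_i * Gamma (a - i%:R - 1)))//.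
rewrite big_mkcond; apply: eq_bigr => i _; case: ifPn => //.
by rewrite -leqNgt => ?; rewrite nth_default// mul0r.
Qed.

Lemma bessel_moment_is_linear a : linear (bessel_moment a : {poly R} -> R^o).
Proof.
move=> c q r; pose n := maxn (size q) (size r).
have cqn : (size (c *: q + r)%R <= n)%N.
  rewrite (leq_trans (size_polyD _ _))// geq_max leq_maxr andbT.
  exact: leq_trans (size_scale_leq _ _) (leq_maxl _ _).
rewrite (bessel_moment_widen _ cqn) (bessel_moment_widen _ (leq_maxl _ _ : (size q <= n)%N)).
rewrite (bessel_moment_widen _ (leq_maxr _ _ : (size r <= n)%N)).
rewrite scaler_sumr -big_split; apply: eq_bigr => i _ /=.
by rewrite coefD coefZ mulrDl /GRing.scale /= mulrA.
Qed.

HB.instance Definition _ a :=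
  GRing.isLinear.Build R {poly R} R^o _ (bessel_moment a) (bessel_moment_is_linear a).

Lemma bessel_momentXnM a j q : bessel_moment a ('X^j * q) = bessel_moment (a - j%:R) q.
Proof.
rewrite (@bessel_moment_widen _ _ (j + size q)); last first.
  by rewrite (leq_trans (size_polyMleq _ _))// size_polyXn.
rewrite big_split_ord /= big1 ?add0r; last first.
  by move=> i _; rewrite coefXnM ltn_ord mul0r.
apply: eq_bigr => i _; rewrite coefXnM ltnNge leq_addr /= addKn natrD.
by congr (_ * Gamma _); ring.
Qed.

Lemma bessel_momentXn a j : bessel_moment a 'X^j = Gamma (a - j%:R - 1).
Proof.
by rewrite -['X^j]mulr1 bessel_momentXnM /bessel_moment size_poly1 big_ord1 coefC mul1r subr0.
Qed.

(* The integrand is the derivative of [t^b e^(-1/t) q(t)]. *)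
Lemma bessel_moment_deriv b q : b + (size q)%:R < 1 ->
  bessel_moment (2 - b) ((b *: 'X + 1) * q + 'X^2 * q^`()) = 0.
Proof.
move=> bq; pose T (q : {poly R}) : {poly R} := (b *: 'X + 1) * q + 'X^2 * q^`().
have -> : (b *: 'X + 1) * q + 'X^2 * q^`() = \sum_(i < size q) q`_i *: T 'X^i.
  rewrite -{1 2}[q]coefK poly_def linear_sum /= !mulr_sumr -big_split /=.
  by apply: eq_bigr => i _; rewrite derivZ -!scalerAr -scalerDr.
rewrite linear_sum big1// => i _; rewrite linearZ /=.
have -> : T 'X^i = (b + i%:R) *: 'X^(i.+1) + 'X^i.
  rewrite /T derivXn; case: (nat_of_ord i) => [|k] /=.
    by rewrite mulr0n mulr0 addr0 !expr0 addr0 !mulr1 expr1.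
  by rewrite -!mul_polyC polyCD polyC_natr -mulr_natr !exprS expr0; ring.
rewrite linearD linearZ /= !bessel_momentXn.
(* On X^i the claim is the functional equation of [Gamma] at -(b + i), positive because i is below
   the size of q. *)
have ib : 0 < - (b + i%:R).
  rewrite oppr_gt0; have : i.+1%:R <= (size q)%:R :> R by rewrite ler_nat.
  by rewrite -natr1; lra.
have -> : 2 - b - i.+1%:R - 1 = - (b + i%:R) by rewrite -natr1; ring.
have -> : 2 - b - i%:R - 1 = - (b + i%:R) + 1 by ring.
by rewrite GammaS// /GRing.scale /=; ring.
Qed.

(** The weight t^(a-2n) e^(-1/t) times [rodrigues_poly a n] is the n-th derivative of t^a e^(-1/t).
    Moving the n derivatives to t^j leaves the factor [j ^_ n], which is 0 for j < n: this is the
    source of orthogonality. *)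
Lemma bessel_moment_rodrigues a n j : a - n%:R + 1 + j%:R < 0 ->
  bessel_moment (n.*2%:R - a) ('X^j * rodrigues_poly a n) =
  (-1) ^+ n * (j ^_ n)%:R * Gamma (- a - j%:R + n%:R - 1).
Proof.
elim: n j => [|n IH] j anj.
  rewrite mulr1 bessel_momentXn expr0 ffactn0 !mul1r double0.
  by congr Gamma; rewrite sub0r addr0.
rewrite /=; set r := rodrigues_poly a n; set b := a - n.*2%:R.
(* Product rule: the operator of [bessel_moment_deriv] applied to X^j r has the extra term j X^(j+1)
   r, and the moment of the rest is 0. *)
have -> : 'X^j * ((b *: 'X + 1) * r + 'X^2 * r^`()) =
    ((b *: 'X + 1) * ('X^j * r) + 'X^2 * ('X^j * r)^`()) - j%:R *: ('X^(j.+1) * r).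
  rewrite derivM derivXn; case: j {anj} => [|j] /=.
    by rewrite mulr0n scale0r !expr0; ring.
  rewrite scaler_nat mulrnAl !exprS; ring.
have -> : n.+1.*2%:R - a = 2 - b by rewrite /b doubleS -addn2 natrD; ring.
rewrite linearB linearZ /= bessel_moment_deriv ?sub0r; last first.
  have : (size ('X^j * r)%R)%:R <= j%:R + n.+1%:R :> R.
    rewrite -natrD ler_nat (leq_trans (size_polyMleq _ _))// size_polyXn.
    by rewrite addSn /= leq_add2l size_rodrigues_poly.
  by move: anj; rewrite /b -muln2 natrM -!natr1; lra.
case: j anj => [|j] anj.
  by rewrite scale0r oppr0 ffact0n mulr0 mul0r.
(* Extracting X^2 lowers the exponent 2 - b by 2, to the one of the induction hypothesis. *)
have -> : 'X^(j.+2) * r = 'X^2 * ('X^j * r) by rewrite -[j.+2]add2n exprD mulrA.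
rewrite bessel_momentXnM [2 - b - _](_ : _ = n.*2%:R - a); last by rewrite /b; ring.
rewrite IH; last by move: anj; rewrite -!natr1; lra.
rewrite ffactSS natrM exprS.
have -> : - a - j.+1%:R + n.+1%:R - 1 = - a - j%:R + n%:R - 1 by rewrite -!natr1; ring.
by rewrite /GRing.scale /=; ring.
Qed.

(** Step k multiplies the coefficient of X^k by a - 2k through the linear factor and by k through
    X^2 r', in total by a - k. *)
Lemma coef_rodrigues_poly a n :
  (rodrigues_poly a n)`_n = \prod_(k < n) (a - k%:R).
Proof.
elim: n => [|n IH]; first by rewrite big_ord0 coefC.
rewrite big_ord_recr /= -IH; set r := rodrigues_poly a n.
rewrite mulrDl mul1r !coefD -scalerAl coefZ coefXM coefXnM /=.
have -> : r`_n.+1 = 0 by rewrite nth_default// size_rodrigues_poly.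
case: n @r {IH} => [|n] r /=; first by rewrite !addr0 subr0; ring.
by rewrite ?ltnS ?ltn0 /= ?subSS ?subn1 ?subn0 /= coef_deriv -mulr_natr -muln2 natrM -!natr1; ring.
Qed.

Lemma bessel_moment_bessel_Xn p n j : n%:R + j%:R + 1 < p ->
  bessel_moment p ('X^j * bessel_poly n p) = (j ^_ n)%:R * Gamma (p - n%:R - j%:R - 1).
Proof.
move=> pn; rewrite bessel_polyE -scalerAr linearZ /=.
have := @bessel_moment_rodrigues (- p + n.*2%:R) n j.
have -> : n.*2%:R - (- p + n.*2%:R) = p by ring.
move=> ->; last first.
  by rewrite -muln2 natrM; lra.
rewrite /GRing.scale /= !mulrA -expr2 sqrr_sign mul1r.
by congr (_ * Gamma _); rewrite -muln2 natrM; ring.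
Qed.

(** The coefficient of X^n is the rising factorial (p-2n)(p-2n+1)...(p-n-1), a quotient of two Gamma
    values; positivity of [Gamma] then shows that the degree is exactly n. *)
Lemma Gamma_coef_bessel p n : 2 * n%:R < p ->
  Gamma (p - n%:R) = (bessel_poly n p)`_n * Gamma (p - n.*2%:R).
Proof.
move=> pn; rewrite bessel_polyE coefZ coef_rodrigues_poly.
have -> : (-1) ^+ n * \prod_(k < n) (- p + n.*2%:R - k%:R) =
    \prod_(k < n) (p - n.*2%:R + k%:R) :> R.
  rewrite -[n in (-1) ^+ n]card_ord -prodrN; apply: eq_bigr => k _; ring.
rewrite -Gamma_prod; last by rewrite -muln2 natrM; lra.
by congr Gamma; rewrite -muln2 natrM; ring.
Qed.

Lemma coef_bessel_neq0 p n : 2 * n%:R < p -> (bessel_poly n p)`_n != 0.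
Proof.
move=> pn; have : 0 < Gamma (p - n%:R) by apply: Gamma_gt0; have := ler0n R n; lra.
by rewrite Gamma_coef_bessel//; apply: contraTneq => ->; rewrite mul0r ltxx.
Qed.

Lemma bessel_moment_bessel_le p l n : (l <= n)%N -> 2 * n%:R + 1 < p ->
  bessel_moment p (bessel_poly l p * bessel_poly n p) =
  (l == n)%:R * (h_const n p / c_const p).
Proof.
move=> ln pn; have n0 := ler0n R n.
have lnR : l%:R <= n%:R :> R by rewrite ler_nat.
rewrite -[X in X * _]coefK poly_def mulr_suml linear_sum /=.
under eq_bigr => i _.
  rewrite -scalerAl linearZ /= bessel_moment_bessel_Xn; last first.
    have : i%:R <= l%:R :> R.
      by rewrite ler_nat -ltnS (leq_trans (ltn_ord i))// size_bessel_poly.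
    lra.
  over.
(* Powers below n have moment 0 against [bessel_poly n p], and l <= n, so only X^n can contribute,
   and only when l = n. *)
rewrite (bigID (fun i : 'I_(size (bessel_poly l p)) => i == n :> nat)) /= [X in _ + X]big1 ?addr0.
  2: { move=> i iNn; rewrite ffact_small ?mul0r ?scaler0//.
       rewrite ltn_neqAle iNn /= -ltnS (leq_trans (ltn_ord i))//.
       by rewrite (leq_trans (size_bessel_poly _ _)). }
have [e|lNn] := eqVneq l n; last first.
  rewrite mul0r big1// => i /eqP ie; have := ltn_ord i; rewrite ie => ns.
  have := leq_trans ns (size_bessel_poly _ _); rewrite ltnS => nl.
  by move: lNn; rewrite eqn_leq ln nl.
rewrite mul1r {l lnR ln}e.
have cn0 : (bessel_poly n p)`_n != 0 by apply: coef_bessel_neq0; lra.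
have sn : (n < size (bessel_poly n p))%N.
  by rewrite ltnNge; apply: contraNN cn0 => ?; rewrite nth_default.
rewrite (big_pred1 (Ordinal sn)) => [|i]; last by [].
rewrite /= ffactnn /h_const /c_const invrK /gfact subrK Gamma_coef_bessel; last by lra.
(* The surviving term carries Gamma(p-2n-1) = Gamma(p-2n) / (p-2n-1), the origin of the denominator
   of [h_const]. *)
have -> : p - n.*2%:R = (p - n%:R - n%:R - 1) + 1 by rewrite -muln2 natrM; ring.
have z0 : 0 < p - n%:R - n%:R - 1 by lra.
rewrite addrK GammaS// /GRing.scale /=; field.
by rewrite !gt_eqF// Gamma_gt0//; lra.
Qed.

Lemma bessel_moment_bessel p l n : 2 * (maxn l n)%:R + 1 < p ->
  bessel_moment p (bessel_poly l p * bessel_poly n p) =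
  (l == n)%:R * (h_const n p / c_const p).
Proof.
case: (leqP l n) => [ln|/ltnW nl] pn; first exact: bessel_moment_bessel_le.
rewrite mulrC bessel_moment_bessel_le// eq_sym; case: eqVneq => [->//|_].
by rewrite !mul0r.
Qed.

(** Triangularity: a multiple of the top Bessel polynomial, whose leading coefficient is nonzero,
    cancels the top coefficient of q. The parameter p is the same for all l. *)
Lemma bessel_span p n q : 2 * n%:R < p -> (size q <= n.+1)%N ->
  exists c : nat -> R, q = \sum_(l < n.+1) c l *: bessel_poly l p.
Proof.
elim: n q => [|n IH] q pn qn.
  exists (fun=> q`_0); rewrite big_ord1 bessel_polyE expr0 scale1r /=.
  by rewrite (size1_polyC qn) alg_polyC coefC.
have pn' : 2 * n%:R < p by move: pn; rewrite -natr1; lra.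
have c0 := coef_bessel_neq0 pn; set N := bessel_poly n.+1 p in c0.
pose cn := q`_n.+1 / N`_n.+1.
have [|c qE] := IH (q - cn *: N) pn'.
  apply/leq_sizeP => j; rewrite leq_eqVlt => /predU1P[<-|nj].
    by rewrite coefB coefZ divfK// subrr.
  have qj : (size q <= j)%N by apply: leq_trans nj.
  have Nj : (size N <= j)%N by apply: leq_trans (size_bessel_poly _ _) _.
  by rewrite coefB coefZ !nth_default// mulr0 subrr.
exists (fun l => if (l < n.+1)%N then c l else cn).
rewrite big_ord_recr /= ltnn -/N; apply/eqP; rewrite -subr_eq qE; apply/eqP.
by apply: eq_bigr => i _; rewrite ltn_ord.
Qed.

Lemma c_const_gt0 p : 1 < p -> 0 < c_const p.
Proof. by move=> p1; rewrite /c_const invr_gt0 Gamma_gt0// subr_gt0. Qed.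

Lemma h_const_gt0 n p : 2 * n%:R + 1 < p -> 0 < h_const n p.
Proof.
move=> pn; have n0 := ler0n R n; rewrite /h_const /gfact subrK -muln2 natrM.
rewrite divr_gt0 ?mulr_gt0 ?Gamma_gt0 ?ltr0n ?fact_gt0//; lra.
Qed.

End BesselMoments.

(** * Ball and cone integrals of polynomials *)

Section LinearExtension.
Variables (R : realType) (n : nat) (V : lmodType R) (phi : multinom n -> V).
Implicit Types (P Q : mpoly n R) (k : multinom n).

Definition mlin P : V := \sum_(k <- msupp P) mcoeff k P *: phi k.

Lemma mlin_widen P b : (msize P <= b)%N ->
  mlin P = \sum_(k : bmultinom n b) mcoeff k P *: phi k.
Proof.
move=> Pb; pose I : subFinType _ := bmultinom n b.
rewrite /mlin (big_mksub I) //=; first last.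
  by move=> x /msize_mdeg_lt /leq_trans; apply.
  by rewrite msupp_uniq.
by rewrite big_rmcond //= => i; move/memN_msupp_eq0 ->; rewrite scale0r.
Qed.

Lemma mlin_is_linear : linear mlin.
Proof.
move=> c P Q; pose b := maxn (msize (c *: P + Q)) (maxn (msize P) (msize Q)).
rewrite !(@mlin_widen _ b) ?leq_max ?leqnn ?orbT//.
rewrite scaler_sumr -big_split; apply: eq_bigr => k _ /=.
by rewrite mcoeffD mcoeffZ scalerDl scalerA.
Qed.

HB.instance Definition _ :=
  GRing.isLinear.Build R (mpoly n R) V _ mlin mlin_is_linear.

Lemma mlinX k : mlin (mpolyX R k) = phi k.
Proof. by rewrite /mlin msuppX big_seq1 mcoeffX eqxx scale1r. Qed.

End LinearExtension.

Section IntegralPoly.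
Context d (T : measurableType d) (R : realType) (mu : {measure set T -> \bar R}).
Variables (D : set T) (mD : measurable D).

Lemma Rintegral_lincomb (I : eqType) (s : seq I) (c : I -> R) (f : I -> T -> R) :
  {in s, forall i, mu.-integrable D (EFin \o f i)} ->
  mu.-integrable D (EFin \o (fun z => \sum_(i <- s) c i * f i z)) /\
  \int[mu]_(z in D) (\sum_(i <- s) c i * f i z) =
  \sum_(i <- s) c i * \int[mu]_(z in D) f i z.
Proof.
elim: s => [_|i s IH fs].
  rewrite big_nil; split.
    by have := integrable0 mu D; apply: eq_integrable => // z _; rewrite /= big_nil.
  under eq_Rintegral do rewrite big_nil.
  by rewrite Rintegral_cst// mul0r.
have fi : mu.-integrable D (EFin \o f i) by apply: fs; rewrite mem_head.
have cfi : mu.-integrable D (EFin \o (fun z => c i * f i z)).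
  by have := integrableZl mD (c i) fi; apply: eq_integrable.
have fs' : {in s, forall i, mu.-integrable D (EFin \o f i)}.
  by move=> j js; apply: fs; rewrite in_cons js orbT.
have [iS vS] := IH fs'.
split.
  have := integrableD mD cfi iS; apply: eq_integrable => // z _.
  by rewrite /= big_cons EFinD.
under eq_Rintegral do rewrite big_cons.
by rewrite RintegralD// vS RintegralZl// big_cons.
Qed.

Variables (n : nat) (ev : T -> 'I_n -> R).

Lemma Rintegral_mlin (W : T -> R) (G : mpoly n R) :
  {in msupp G, forall k, mu.-integrable D
    (EFin \o (fun z => meval (ev z) (mpolyX R k) * W z))} ->
  mu.-integrable D (EFin \o (fun z => meval (ev z) G * W z)) /\
  \int[mu]_(z in D) (meval (ev z) G * W z) =
  mlin (fun k => (\int[mu]_(z in D) (meval (ev z) (mpolyX R k) * W z) : R^o)) G.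
Proof.
move=> iX; have GE z : meval (ev z) G * W z =
    \sum_(k <- msupp G) mcoeff k G * (meval (ev z) (mpolyX R k) * W z).
  rewrite mevalE mulr_suml; apply: eq_bigr => k _.
  by rewrite mevalX mulrA.
have [iS vS] := Rintegral_lincomb (fun k => mcoeff k G) iX; split.
  by move: iS; apply: eq_integrable => // z _; rewrite /= GE.
by rewrite [RHS](esym vS); apply: eq_Rintegral => z _; rewrite GE.
Qed.

Lemma measurable_meval (G : mpoly n R) : (forall i, measurable_fun setT (ev ^~ i)) ->
  measurable_fun setT (fun z => meval (ev z) G).
Proof.
move=> mev; under eq_fun do rewrite mevalE.
apply: measurable_sum => k; apply: measurable_funM => //.
by apply: measurable_prod => i _; exact: measurable_funX.
Qed.

End IntegralPoly.

Lemma meval_bounded (R : realType) n (G : mpoly n R) :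
  exists2 C, 0 <= C & forall v, (forall i, `|v i| <= 1) -> `|meval v G| <= C.
Proof.
exists (\sum_(k <- msupp G) `|mcoeff k G|); first by apply: sumr_ge0.
move=> v v1; rewrite mevalE (le_trans (ler_norm_sum _ _ _))//.
apply: ler_sum => k _; rewrite normrM ler_piMr//.
rewrite normr_prod prodr_ile1// => i _.
by rewrite normr_ge0 normrX exprn_ile1.
Qed.

Section BallCone.
Variables (R : realType) (d : nat) (mu : R).
Local Notation M := (measurableTypeR R).
Local Notation lam := (@lebesgue_measure R).
Local Notation lamd := (lebesgue_tuple R d).
Local Notation w := (@weight_ball R d mu).
Hypothesis iw : lamd.-integrable (@ball1 R d) (EFin \o w).

Lemma tnth_cone_point (x : d.-tuple R) (t : R) i :
  tnth (cone_point x t) i = if unlift ord_max i is Some j then tnth x j else t.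
Proof.
case: unliftP => [j ->|->]; rewrite (tnth_nth t).
  by rewrite lift_max /= nth_rcons size_tuple ltn_ord -tnth_nth.
by rewrite /= nth_rcons size_tuple ltnn eqxx.
Qed.

Lemma ball1_coord (x : d.-tuple R) i : enorm x <= 1 -> `|tnth x i| <= 1.
Proof.
move=> x1; rewrite -sqrtr_sqr (le_trans _ x1)// ler_sqrt ?sqr_ge0//; last first.
  by apply: sumr_ge0 => j _; exact: sqr_ge0.
by rewrite (bigD1 i)//= lerDl sumr_ge0// => j _; exact: sqr_ge0.
Qed.

(** The evaluation point is left general to cover both x and (x, 1); bounded coordinates give a
    bounded polynomial, so a multiple of the weight dominates. *)
Lemma integrable_meval_ball n (ev : d.-tuple M -> 'I_n -> R) (G : mpoly n R) :
  (forall i, measurable_fun setT (ev ^~ i)) ->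
  (forall x i, enorm x <= 1 -> `|ev x i| <= 1) ->
  lamd.-integrable (@ball1 R d) (EFin \o (fun x => meval (ev x) G * w x)).
Proof.
move=> mev ev1; have [C C0 HC] := meval_bounded G.
have mB := @measurable_ball1 R d.
apply: (le_integrable mB _ _ (integrableZl mB C iw)).
  apply/measurable_EFinP; apply: measurable_funTS; apply: measurable_funM.
    exact: measurable_meval.
  exact: measurable_weight_ball.
move=> x xB /=; rewrite lee_fin !normrM ler_wpM2r//.
by rewrite [leRHS]ger0_norm// HC// => i; exact: ev1.
Qed.

(** The inner product depends only on the product of its arguments, so linearity needs to be studied
    for one argument only. *)
Definition ball_mean (F : mpoly d R) : R :=
  b_ball d mu * \int[lamd]_(x in @ball1 R d) (meval (tnth x) F * w x).

Lemma ip_ball_mean F G : ip_ball mu F G = ball_mean (F * G).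
Proof.
by rewrite /ip_ball /ball_mean; congr (_ * _); apply: eq_Rintegral => x _; rewrite mevalM.
Qed.

Lemma ball_mean_mlin F : ball_mean F = mlin (fun k => (ball_mean (mpolyX R k) : R^o)) F.
Proof.
rewrite /ball_mean (Rintegral_mlin (@measurable_ball1 R d) _).2.
  by rewrite /mlin mulr_sumr; apply: eq_bigr => k _; rewrite /GRing.scale /=; ring.
move=> k _; apply: integrable_meval_ball => [i|x i]; first exact: measurable_tnth.
exact: ball1_coord.
Qed.

Variable p : R.
Local Notation al := (alpha d mu).

Definition cone_mean (G : mpoly d.+1 R) : R :=
  b_cone d mu p * \int[(lamd \x lam)%E]_(z in @Defs.cone R d)
    (meval (tnth (cone_point z.1 z.2)) G * weight_cone mu p z.1 z.2).

Lemma ip_cone_mean F G : ip_cone mu p F G = cone_mean (F * G).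
Proof.
by rewrite /ip_cone /cone_mean; congr (_ * _); apply: eq_Rintegral => x _; rewrite mevalM.
Qed.

Hypothesis p0 : 0 < p.

(* A monomial is homogeneous of degree [mdeg k], so at [t > 0] it is [t ^+ mdeg k]
   times its value at the point [(x / t, 1)]. *)
Lemma integrable_monomial_cone (k : multinom d.+1) : 1 < p - 2 * al - (mdeg k)%:R ->
  (lamd \x lam)%E.-integrable (@Defs.cone R d)
    (EFin \o (fun z => meval (tnth (cone_point z.1 z.2)) (mpolyX R k) *
                       weight_cone mu p z.1 z.2)).
Proof.
move=> pk; pose Phi (x : d.-tuple M) := meval (tnth (cone_point x 1)) (mpolyX R k).
have [] // := @cone_integral R d mu p (mdeg k) Phi
  (fun z => meval (tnth (cone_point z.1 z.2)) (mpolyX R k)).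
- by rewrite gt_eqF.
- move=> x t t0 /=; rewrite /Phi !mevalX mdegE -prodrXr -big_split /=.
  apply: eq_bigr => i _; rewrite -exprMn; congr (_ ^+ _).
  rewrite !tnth_cone_point; case: unlift => [j|]; last by rewrite mulr1.
  by rewrite tnth_mktuple mulrC divfK// gt_eqF.
- apply: integrable_meval_ball => [i|x i x1].
    apply: (eq_measurable_fun (fun x : d.-tuple M =>
      if unlift ord_max i is Some j then tnth x j else 1)).
      by move=> x _; rewrite /= tnth_cone_point.
    by case: unlift => [j|]; [exact: measurable_tnth|exact: measurable_cst].
  rewrite tnth_cone_point; case: unlift => [j|]; last by rewrite normr1.
  exact: ball1_coord.
Qed.

Local Notation L := (mlin (fun k => (cone_mean (mpolyX R k) : R^o))).

(** [msize] is the degree plus one: the bound is the integrability condition of every monomial of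
    G. *)
Lemma cone_mean_mlin G : (msize G)%:R < p - 2 * al -> cone_mean G = L G.
Proof.
move=> Gp; rewrite /cone_mean (Rintegral_mlin (@measurable_cone R d) _).2.
  by rewrite /mlin mulr_sumr; apply: eq_bigr => k _; rewrite /GRing.scale /= /cone_mean; ring.
move=> k /msize_mdeg_lt kG; apply: integrable_monomial_cone.
have : (mdeg k).+1%:R <= (msize G)%:R :> R by rewrite ler_nat.
rewrite -natr1; lra.
Qed.

(** H enters only through its values for t > 0, so that it can be a product of two homogenizations,
    with F the product of the ball polynomials and j the sum of their degrees. *)
Lemma cone_mean_separated (q : {poly R}) (H : mpoly d.+1 R) (F : mpoly d R) (j : nat) :
  (size q)%:R + j%:R < p - 2 * al ->
  (forall x t, 0 < t ->
    meval (tnth (cone_point x t)) H = t ^+ j * meval (fun i => tnth x i / t) F) ->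
  cone_mean (horner_alg (var_t R d) q * H) =
  c_const (p - 2 * al) * bessel_moment (p - 2 * al - j%:R) q * ball_mean F.
Proof.
move=> qj HE.
pose f i (z : d.-tuple M * M) : R :=
  z.2 ^+ i * meval (tnth (cone_point z.1 z.2)) H * weight_cone mu p z.1 z.2.
have cf i : (i < size q)%N ->
    (lamd \x lam)%E.-integrable (@Defs.cone R d) (EFin \o f i) /\
    \int[(lamd \x lam)%E]_(z in @Defs.cone R d) f i z =
    Gamma (p - 2 * al - (j + i)%:R - 1) *
    \int[lamd]_(x in @ball1 R d) (meval (tnth x) F * w x).
  move=> iq; apply: (@cone_integral R d mu p (j + i) (fun x => meval (tnth x) F)
    (fun z => z.2 ^+ i * meval (tnth (cone_point z.1 z.2)) H)).
  - by rewrite gt_eqF.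
  - have : i.+1%:R <= (size q)%:R :> R by rewrite ler_nat.
    by rewrite natrD -natr1; lra.
  - move=> x t t0 /=; rewrite HE// mulrA -exprD addnC; congr (_ * _).
    by apply: meval_eq => l; rewrite tnth_mktuple.
  - apply: integrable_meval_ball => [l|x l]; first exact: measurable_tnth.
    exact: ball1_coord.
have cf' : {in index_iota 0 (size q), forall i,
    (lamd \x lam)%E.-integrable (@Defs.cone R d) (EFin \o f i)}.
  by move=> i; rewrite mem_index_iota => /cf[].
have [_ vS] := Rintegral_lincomb (@measurable_cone R d) (fun i => q`_i) cf'.
rewrite /cone_mean [X in _ * X](_ : _ = \int[(lamd \x lam)%E]_(z in @Defs.cone R d)
    (\sum_(i <- index_iota 0 (size q)) q`_i * f i z)); last first.
  apply: eq_Rintegral => z _; rewrite mevalM meval_horner_alg horner_coef.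
  rewrite big_mkord !mulr_suml; apply: eq_bigr => i _; rewrite /f; ring.
rewrite vS /b_cone /ball_mean.
have -> : p - 2 * mu - d%:R + 1 = p - 2 * al by rewrite /alpha; field.
set b := b_ball d mu; set c := c_const _; set I := \int[lamd]_(x in _) _.
have -> : \sum_(i <- index_iota 0 (size q))
      q`_i * \int[(lamd \x lam)%E]_(z in @Defs.cone R d) f i z =
    bessel_moment (p - 2 * al - j%:R) q * I.
  rewrite big_mkord /bessel_moment mulr_suml; apply: eq_bigr => i _.
  rewrite (cf i (ltn_ord i)).2 natrD mulrA; congr (_ * Gamma _ * _); ring.
ring.
Qed.

End BallCone.

(** * Spanning families *)

Section LinearSpan.
Variables (R : realType) (V : lmodType R) (X : Type).

(** An inductive span fixes no finite index set, and linear properties follow by induction on the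
    derivation. *)
Inductive lspan (f : X -> V) (A : X -> Prop) : V -> Prop :=
| lspan0 : lspan f A 0
| lspan_cons c x v : A x -> lspan f A v -> lspan f A (c *: f x + v).

Lemma lspan_mem f (A : X -> Prop) x : A x -> lspan f A (f x).
Proof.
by move=> Ax; rewrite -[f x]scale1r -[_ *: _]addr0; apply: lspan_cons (lspan0 _ _).
Qed.

Lemma lspanD f A u v : lspan f A u -> lspan f A v -> lspan f A (u + v).
Proof.
move=> fu fv; elim: fu => [|c x {}u Ax _ IH]; first by rewrite add0r.
by rewrite -addrA; exact: lspan_cons.
Qed.

Lemma lspanZ f A c u : lspan f A u -> lspan f A (c *: u).
Proof.
elim=> [|c' x {}u Ax _ IH]; first by rewrite scaler0; exact: lspan0.
by rewrite scalerDr scalerA; exact: lspan_cons.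
Qed.

Lemma lspan_sum (I : Type) (s : seq I) (Q : pred I) f A (F : I -> V) :
  (forall i, Q i -> lspan f A (F i)) -> lspan f A (\sum_(i <- s | Q i) F i).
Proof. by move=> H; apply: big_ind => //; [exact: lspan0|exact: lspanD]. Qed.

End LinearSpan.

(** * Degrees and homogenization *)

Section Homogenize.
Variables (R : realType) (d : nat).
Implicit Types (P : mpoly d R).
Local Notation t := (var_t R d).

Lemma msizeM_bound n (F G : mpoly n R) a b : (msize F <= a.+1)%N -> (msize G <= b.+1)%N ->
  (msize (F * G) <= (a + b).+1)%N.
Proof.
move=> Fa Gb; have [->|F0] := eqVneq F 0; first by rewrite mul0r msize0.
have [->|G0] := eqVneq G 0; first by rewrite mulr0 msize0.
rewrite msizeM//; move: Fa Gb; move: (msize F) (msize G) => u v; lia.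
Qed.

Lemma msize_sum_bound n (I : Type) (s : seq I) (F : I -> mpoly n R) (Q : pred I) b :
  (forall i, Q i -> (msize (F i) <= b)%N) -> (msize (\sum_(i <- s | Q i) F i)%R <= b)%N.
Proof.
move=> Fb; elim/big_ind : _ => [|G H Gb Hb|//]; first by rewrite msize0.
by rewrite (leq_trans (msizeD_le _ _))// geq_max Gb.
Qed.

Lemma horner_alg_var_tE (q : {poly R}) :
  horner_alg t q = \sum_(i < size q) q`_i *: t ^+ i.
Proof.
rewrite -{1}[q]coefK poly_def linear_sum /=.
by apply: eq_bigr => i _; rewrite linearZ rmorphXn /= horner_algX mulr_algl.
Qed.

Lemma var_tXn i : t ^+ i = mpolyX R (mnm_muln (mnm1 ord_max) i).
Proof. by rewrite mpolyXn. Qed.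

Lemma msize_var_tXn i : msize (t ^+ i) = i.+1.
Proof. by rewrite var_tXn msizeX mdegMn mdeg1 mul1n. Qed.

Lemma msize_horner_alg_var_t (q : {poly R}) n :
  (size q <= n.+1)%N -> (msize (horner_alg t q) <= n.+1)%N.
Proof.
move=> qn; rewrite horner_alg_var_tE; apply: msize_sum_bound => i _.
rewrite (leq_trans (msizeZ_le _ _))// msize_var_tXn.
exact: leq_trans (ltn_ord i) qn.
Qed.

Lemma msize_mwidenX k : msize (mwiden (mpolyX R (n := d) k)) = (mdeg k).+1.
Proof.
rewrite mwidenX msizeX !mdegE big_ord_recr /= mnmwiden_ordmax addn0.
by congr _.+1; apply: eq_bigr => i _; rewrite mnmwiden_widen.
Qed.

Lemma msize_homogenize m P : (msize P <= m.+1)%N -> (msize (homogenize m P) <= m.+1)%N.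
Proof.
move=> Pm; rewrite /homogenize big_seq_cond; apply: msize_sum_bound => k.
rewrite andbT => /msize_mdeg_lt kP.
rewrite (leq_trans (msizeZ_le _ _))//.
have km : (mdeg k <= m)%N by rewrite -ltnS (leq_trans kP).
rewrite -[in X in (_ <= X)%N](subnKC km); apply: msizeM_bound.
  by rewrite msize_mwidenX.
by rewrite msize_var_tXn.
Qed.

Definition hom_mono m (k : multinom d) : mpoly d.+1 R :=
  mwiden (mpolyX R k) * t ^+ (m - mdeg k).

Lemma homogenize_mlin m P : homogenize m P = mlin (hom_mono m) P.
Proof. by []. Qed.

Lemma homogenize_widen m s P : (msize P <= m.+1)%N -> (m <= s)%N ->
  homogenize s P = t ^+ (s - m) * homogenize m P.
Proof.
move=> Pm ms; rewrite /homogenize mulr_sumr !big_seq; apply: eq_bigr => k.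
move=> /msize_mdeg_lt kP; have km : (mdeg k <= m)%N by rewrite -ltnS (leq_trans kP).
rewrite -scalerAr mulrCA -exprD; congr (_ *: (_ * _ ^+ _)); lia.
Qed.

Lemma mpolyX_homogenize (k : multinom d.+1) : exists2 k' : multinom d,
  mdeg k = (mdeg k' + k ord_max)%N &
  mpolyX R k = homogenize (mdeg k') (mpolyX R k') * t ^+ (k ord_max).
Proof.
pose k' : multinom d := Multinom [tuple k (widen_ord (leqnSn d) i) | i < d].
have kE : k = mnm_add (mnmwiden k') (mnm_muln (mnm1 ord_max) (k ord_max)).
  apply/mnmP => i; rewrite mnmDE mulmnE mnm1E.
  case: (unliftP ord_max i) => [j ->|->].
    have -> : lift ord_max j = widen_ord (leqnSn d) j.
      by apply: val_inj; rewrite /= /bump leqNgt ltn_ord.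
    rewrite mnmwiden_widen mnmE -val_eqE /=.
    by rewrite gtn_eqF ?mul0n ?addn0.
  by rewrite mnmwiden_ordmax eqxx mul1n.
exists k'.
  rewrite {1}kE mdegD mdegMn mdeg1 mul1n; congr (_ + _)%N.
  rewrite !mdegE big_ord_recr /= mnmwiden_ordmax addn0.
  by apply: eq_bigr => i _; rewrite mnmwiden_widen.
rewrite {1}kE mpolyXD homogenize_mlin mlinX /hom_mono subnn expr0 mulr1 mwidenX.
by rewrite var_tXn.
Qed.

End Homogenize.

(** * Spanning and orthogonality of the cone polynomials *)

Section MainProof.
Variables (R : realType) (d : nat) (mu p : R) (P : multinom d -> mpoly d R).
Local Notation lamd := (lebesgue_tuple R d).
Local Notation w := (@weight_ball R d mu).
Local Notation E := (@ball_mean R d mu).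
Hypothesis P_basis : forall m : nat,
  orthonormal_basis (ip_ball mu)
    [pred k : bmultinom d m.+1 | mdeg k == m]
    (fun k : bmultinom d m.+1 => P k) (V_ball mu m).

Lemma V_ballP k : V_ball mu (mdeg k) (P k).
Proof.
have [[PV _ _] _] := P_basis (mdeg k).
by apply: (PV (BMultinom (ltnSn (mdeg k)))); rewrite inE.
Qed.

Lemma msizeP k : (msize (P k) <= (mdeg k).+1)%N.
Proof. by have [] := V_ballP k. Qed.

(** The hypothesis compares indices of one degree; for different degrees, the polynomial of higher
    degree is orthogonal to the other by the definition of [V_ball]. *)
Lemma ball_mean_orthonormal k k' : E (P k * P k') = (k == k')%:R.
Proof.
case: (ltngtP (mdeg k) (mdeg k')) => kk'.
- have [_ /(_ (P k))] := V_ballP k'; rewrite ip_ball_mean mulrC => ->.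
    by case: eqVneq kk' => // ->; rewrite ltnn.
  exact: leq_trans (msizeP k) kk'.
- have [_ /(_ (P k'))] := V_ballP k; rewrite ip_ball_mean => ->.
    by case: eqVneq kk' => // ->; rewrite ltnn.
  exact: leq_trans (msizeP k') kk'.
have [_ ortho] := P_basis (mdeg k).
have k'k : (mdeg k' < (mdeg k).+1)%N by rewrite kk'.
pose i := BMultinom (ltnSn (mdeg k)); pose j := BMultinom k'k.
have : ip_ball mu (P i) (P j) = (i == j)%:R.
  have iin : i \in [pred l : bmultinom d (mdeg k).+1 | mdeg l == mdeg k] by rewrite inE /=.
  have jin : j \in [pred l : bmultinom d (mdeg k).+1 | mdeg l == mdeg k].
    by rewrite inE /=; apply/eqP.
  exact: ortho.
by rewrite ip_ball_mean bmeqP.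
Qed.

(* Otherwise the integral defining <P_0, P_0> = 1 would be infinite, hence zero by
   the convention [fine +oo = 0]. *)
Lemma integrable_weight_ball : lamd.-integrable (@ball1 R d) (EFin \o w).
Proof.
have mB := @measurable_ball1 R d.
have mw : measurable_fun (@ball1 R d) (EFin \o w).
  by apply/measurable_EFinP/measurable_funTS; exact: measurable_weight_ball.
have w0 x : 0 <= w x by exact: powR_ge0.
have := ball_mean_orthonormal (@mnm0 d) (@mnm0 d); have := msizeP (@mnm0 d); rewrite eqxx mdeg0.
move=> /msize1_polyC ->; set c := mcoeff _ _.
rewrite /ball_mean (_ : (fun x => _) = (fun x => (c * c) * w x)); last first.
  by apply/funext => x; rewrite mevalM !mevalC.
move=> E1; apply/integrableP; split=> //.
under eq_integral do rewrite /= ger0_norm//.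
rewrite ltNge leye_eq; apply/negP => /eqP wy.
have cc : c * c != 0.
  apply/eqP => cc0; move: E1; under eq_Rintegral do rewrite cc0 mul0r.
  by rewrite Rintegral_cst// mul0r mulr0 => /esym/eqP; rewrite oner_eq0.
move: E1; rewrite /Rintegral.
under eq_integral do rewrite EFinM.
rewrite ge0_integralZl_EFin//; [|by move=> x _; rewrite lee_fin|by rewrite -expr2 sqr_ge0].
rewrite wy gt0_muley ?lte_fin; last by rewrite lt0r cc -expr2 sqr_ge0.
by rewrite /= mulr0 => /esym/eqP; rewrite oner_eq0.
Qed.

Local Notation EL := (mlin (fun k => (E (mpolyX R k) : R^o))).

Lemma ball_meanL F : E F = EL F.
Proof. exact: (ball_mean_mlin integrable_weight_ball). Qed.

Lemma ball_span m F : (msize F <= m)%N -> lspan P (fun k => (mdeg k < m)%N) F.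
Proof.
elim: m F => [|m IH] F Fm.
  by move: Fm; rewrite leqn0 msize_poly_eq0 => /eqP ->; exact: lspan0.
pose S := \sum_(k : bmultinom d m) E (F * P k) *: P k.
have PS k : (mdeg k < m)%N -> E (S * P k) = E (F * P k).
  move=> km; rewrite !ball_meanL /S mulr_suml linear_sum /=.
  rewrite (bigD1 (BMultinom km))//= -scalerAl linearZ /= -!ball_meanL ball_mean_orthonormal eqxx.
  rewrite [X in _ + X]big1 ?addr0 => [|k' k'k]; first by rewrite /GRing.scale /= mulr1.
  rewrite -scalerAl linearZ /= -ball_meanL ball_mean_orthonormal.
  by move: k'k; rewrite bmeqP /= => /negbTE ->; rewrite scaler0.
have mS : (msize S <= m)%N.
  apply: msize_sum_bound => k _; rewrite (leq_trans (msizeZ_le _ _))//.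
  by rewrite (leq_trans (msizeP _))// bmdeg.
have FSV : V_ball mu m (F - S).
  split.
    by rewrite (leq_trans (msizeD_le _ _))// geq_max Fm msizeN (leq_trans mS).
  (* By the induction hypothesis, it is enough to test orthogonality against the [P k] of lower
     degree. *)
  move=> g /IH gP; rewrite ip_ball_mean ball_meanL; elim: gP => [|c k v km _ IHv].
    by rewrite mulr0 linear0.
  rewrite mulrDr linearD /= IHv addr0 -scalerAr linearZ /= mulrBl linearB /=.
  by rewrite -!ball_meanL PS// subrr scaler0.
have [[_ _ /(_ _ FSV) [c FSE]] _] := P_basis m.
rewrite -(subrK S F) FSE; apply: lspanD; apply: lspan_sum => k.
  by rewrite inE => /eqP km; apply/lspanZ/lspan_mem; rewrite km.
by move=> _; apply/lspanZ/lspan_mem; exact: ltnW (bmdeg k).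
Qed.

Local Notation al := (alpha d mu).
Local Notation f x := (cone_poly mu p P x.1 x.2).
Local Notation below n := (fun x : multinom d * nat => (mdeg x.1 <= x.2)%N /\ (x.2 < n)%N).

(** Here [msize g <= n] means degree at most n - 1, and the bound says 2(n - 1) < p - 2 alpha. *)
Lemma cone_span n (g : mpoly d.+1 R) : 2 * n%:R < p - 2 * al + 2 -> (msize g <= n)%N ->
  lspan (fun x => f x) (below n) g.
Proof.
move=> np gn.
(* A component [P k] with |k| <= s contributes t^(s-|k|+j) times its own homogenization; that power
   of t is expanded in Bessel polynomials of parameter p - 2 alpha - 2|k|, the one in
   [cone_poly]. *)
have mono s j F : (s + j < n)%N -> lspan P (fun k => (mdeg k < s.+1)%N) F ->
    lspan (fun x => f x) (below n) (homogenize s F * var_t R d ^+ j).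
  move=> sjn; elim=> [|c k v ks _ IH].
    by rewrite homogenize_mlin linear0 mul0r; exact: lspan0.
  rewrite homogenize_mlin linearP /= -!homogenize_mlin mulrDl -scalerAl.
  apply: lspanD IH; apply: lspanZ; rewrite ltnS in ks.
  rewrite (homogenize_widen (msizeP k) ks) mulrAC -exprD; set i := (_ + j)%N.
  have -> : var_t R d ^+ i = horner_alg (var_t R d) 'X^i by rewrite rmorphXn /= horner_algX.
  have ki : (mdeg k + i < n)%N by rewrite /i; lia.
  have pki : 2 * i%:R < p - 2 * al - (mdeg k).*2%:R.
    have : (mdeg k + i).+1%:R <= n%:R :> R by rewrite ler_nat.
    by rewrite -natr1 natrD -muln2 natrM; lra.
  have si : (size ('X^i : {poly R})%R <= i.+1)%N by rewrite size_polyXn.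
  have [c' ->] := bessel_span pki si.
  rewrite linear_sum mulr_suml; apply: lspan_sum => l _.
  rewrite linearZ /= mulr_algl -scalerAl; apply: lspanZ.
  have := @lspan_mem R _ _ (fun x => f x) (below n) (k, (mdeg k + l)%N).
  rewrite /cone_poly /= addKn; apply; split; first exact: leq_addr.
  by apply: leq_ltn_trans ki; rewrite leq_add2l -ltnS ltn_ord.
rewrite [g]mpolyE big_seq; apply: lspan_sum => k /msize_mdeg_lt kg; apply: lspanZ.
have [k' kk' ->] := mpolyX_homogenize R k.
apply: mono; first by rewrite -kk' (leq_trans kg).
by apply: ball_span; rewrite msizeX.
Qed.

Lemma msize_cone_poly k n : (mdeg k <= n)%N -> (msize (cone_poly mu p P k n) <= n.+1)%N.
Proof.
move=> kn; rewrite -[X in (_ <= X.+1)%N](subnK kn); apply: msizeM_bound.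
  by apply: msize_horner_alg_var_t; exact: size_bessel_poly.
exact: msize_homogenize (msizeP k).
Qed.

(** The ball factor vanishes unless k = k'. In that case both Bessel polynomials have the parameter
    p - 2 alpha - 2|k|, which is also the moment exponent left by t^(|k|+|k'|), so one-variable
    orthogonality applies. *)
Lemma cone_mean_cone_poly k k' n n' : 0 < p -> (mdeg k <= n)%N -> (mdeg k' <= n')%N ->
  2 * (maxn n n')%:R + 1 < p - 2 * al ->
  cone_mean mu p (cone_poly mu p P k n * cone_poly mu p P k' n') =
  H_const d mu p (mdeg k) n * (n == n')%:R * (k == k')%:R.
Proof.
move=> p0 kn k'n' np.
have maxE : (maxn n n')%:R = Num.max (n%:R : R) n'%:R by rewrite natr_max.
have nmax : n%:R + n'%:R <= 2 * (maxn n n')%:R :> R.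
  by rewrite -natrD -natrM ler_nat; lia.
rewrite /cone_poly mulrACA -rmorphM /=.
rewrite (@cone_mean_separated _ _ _ integrable_weight_ball _ p0 _ _
  (P k * P k') (mdeg k + mdeg k')).
- rewrite ball_mean_orthonormal; have [kk'|_] := eqVneq k k'; last by rewrite !mulr0.
  rewrite -{k'}kk' in k'n' *; rewrite !mulr1 addnn bessel_moment_bessel; last first.
    have := maxE; have : 2 * (maxn (n - mdeg k) (n' - mdeg k))%:R + (mdeg k).*2%:R =
      2 * (maxn n n')%:R :> R.
      by rewrite -!natrM -natrD; congr (_%:R); lia.
    by lra.
  have -> : (n - mdeg k == n' - mdeg k)%N = (n == n') by apply/eqP/eqP; lia.
  have [<-|_] := eqVneq n n'; last by rewrite !mul0r !mulr0.
  by rewrite /H_const !mul1r mulr1; ring.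
(* The radial degrees n - |k| and n' - |k'| and the homogeneous degree |k| + |k'| add up to n + n';
   the size adds one. *)
- have : (size (bessel_poly (n - mdeg k) (p - 2 * al - (mdeg k).*2%:R) *
    bessel_poly (n' - mdeg k') (p - 2 * al - (mdeg k').*2%:R))%R + (mdeg k + mdeg k')
     <= n + n' + 1)%N.
    have := size_polyMleq (bessel_poly (n - mdeg k) (p - 2 * al - (mdeg k).*2%:R))
      (bessel_poly (n' - mdeg k') (p - 2 * al - (mdeg k').*2%:R)).
    have := size_bessel_poly (n - mdeg k) (p - 2 * al - (mdeg k).*2%:R).
    have := size_bessel_poly (n' - mdeg k') (p - 2 * al - (mdeg k').*2%:R).
    lia.
  by rewrite -(ler_nat R) !natrD; lra.
- move=> x t t0; rewrite mevalM !homogenizeE ?msizeP ?gt_eqF//.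
  by rewrite exprD mevalM mulrACA.
Qed.

End MainProof.

(** * Expansion in cone polynomials and the basis property *)

Section ConeBasis.
Variables (R : realType) (d : nat) (mu p : R) (P : multinom d -> mpoly d R) (n : nat).
Hypothesis P_basis : forall m : nat,
  orthonormal_basis (ip_ball mu)
    [pred k : bmultinom d m.+1 | mdeg k == m]
    (fun k : bmultinom d m.+1 => P k) (V_ball mu m).
Hypothesis p0 : 0 < p.
Local Notation al := (alpha d mu).
Hypothesis np : 2 * n%:R + 1 < p - 2 * al.
Local Notation f k m := (cone_poly mu p P k m).
Local Notation H k m := (H_const d mu p (mdeg k) m).
Local Notation L := (mlin (fun k => (cone_mean mu p (mpolyX R (n := d.+1) k) : R^o))).
Local Notation iw := (integrable_weight_ball P_basis).

Lemma H_const_gt0 (m l : nat) : (m <= l)%N -> (l <= n)%N -> 0 < H_const d mu p m l.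
Proof.
move=> ml ln; rewrite /H_const.
have lnR : l%:R <= n%:R :> R by rewrite ler_nat.
have n0 := ler0n R n.
have mR : m%:R <= l%:R :> R by rewrite ler_nat.
have m0 := ler0n R m.
have dbl : m.*2%:R = 2 * m%:R :> R by rewrite -muln2 natrM mulrC.
have p1 : 1 < p - 2 * al by move: np n0 => np0 n0; lra.
have p2 : 1 < p - 2 * al - 2 * m%:R by move: np => np0; lra.
have p3 : 2 * (l - m)%:R + 1 < p - 2 * al - 2 * m%:R by move: np; rewrite natrB//; lra.
by apply: mulr_gt0; [apply: divr_gt0; apply: c_const_gt0|apply: h_const_gt0]; rewrite ?dbl.
Qed.

(** Products of polynomials of degree at most n have degree at most 2n, within the range where the
    mean is linear: there [ip_cone] may be used as a bilinear form. *)
Lemma cone_meanM_mlin a b (F G : mpoly d.+1 R) : (msize F <= a.+1)%N -> (msize G <= b.+1)%N ->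
  (a <= n)%N -> (b <= n)%N -> cone_mean mu p (F * G) = L (F * G).
Proof.
move=> Fa Gb an bn; apply: (cone_mean_mlin iw p0).
have : (msize (F * G))%:R <= (n + n).+1%:R :> R.
  by rewrite ler_nat (leq_trans (msizeM_bound Fa Gb))// ltnS leq_add.
by move: np; rewrite -[(n + n).+1%:R]natr1 natrD; lra.
Qed.

Lemma mlin_cone_poly k k' m m' :
  (mdeg k <= m)%N -> (m <= n)%N -> (mdeg k' <= m')%N -> (m' <= n)%N ->
  L (f k m * f k' m') = H k m * (m == m')%:R * (k == k')%:R.
Proof.
move=> km mn k'm' m'n.
rewrite -(cone_meanM_mlin (msize_cone_poly p P_basis km) (msize_cone_poly p P_basis k'm') mn m'n).
rewrite cone_mean_cone_poly//.
have : (maxn m m')%:R <= n%:R :> R by rewrite ler_nat geq_max mn.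
by move: np; lra.
Qed.

(** The Fourier sum over all levels up to n, with [L] for the inner product: it is linear on all
    polynomials, so fixing a spanning family makes it the identity in degree at most n. *)
Definition expansion (v : mpoly d.+1 R) : mpoly d.+1 R :=
  \sum_(m < n.+1) \sum_(k : bmultinom d m.+1) (L (v * f k m) / H k m) *: f k m.

Lemma expansion_is_linear : linear expansion.
Proof.
move=> c u v; rewrite /expansion scaler_sumr -big_split; apply: eq_bigr => m _ /=.
rewrite scaler_sumr -big_split; apply: eq_bigr => k _ /=.
have ZE (x : R) : c *: (x : R^o) = c * x by [].
by rewrite mulrDl linearD /= -scalerAl linearZ /= ZE mulrDl scalerDl scalerA -!mulrA.
Qed.

HB.instance Definition _ :=
  GRing.isLinear.Build R (mpoly d.+1 R) (mpoly d.+1 R) _ expansion expansion_is_linear.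

Lemma expansion_cone_poly k m : (mdeg k <= m)%N -> (m <= n)%N ->
  expansion (f k m) = f k m.
Proof.
move=> km mn; rewrite /expansion (bigD1 (Ordinal (mn : (m < n.+1)%N)))//=.
rewrite (bigD1 (BMultinom (km : (mdeg k < m.+1)%N)))//=.
rewrite mlin_cone_poly// !eqxx !mulr1 divff ?gt_eqF ?H_const_gt0// scale1r.
rewrite big1 ?addr0 => [|k' k'k].
  rewrite big1 ?addr0// => m' m'm; apply: big1 => k' _.
  rewrite mlin_cone_poly ?(ltnSE (bmdeg k')) ?(ltnSE (ltn_ord m'))//.
  by move: m'm; rewrite -val_eqE /= eq_sym => /negbTE ->; rewrite mulr0 !mul0r scale0r.
rewrite mlin_cone_poly ?(ltnSE (bmdeg k'))//.
move: k'k; rewrite bmeqP /= eq_sym => /negbTE ->.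
by rewrite mulr0 mul0r scale0r.
Qed.

Lemma expansionE v : (msize v <= n.+1)%N -> expansion v = v.
Proof.
move=> vn; have nn : 2 * n.+1%:R < p - 2 * al + 2 by move: np; rewrite -[n.+1%:R]natr1; lra.
elim: (cone_span P_basis nn vn) => [|c [k m] u /= [km mn] _ IH]; first exact: linear0.
by rewrite linearP /= IH expansion_cone_poly// -ltnS.
Qed.

(** A polynomial of degree less than n is spanned by the levels m < n, all orthogonal to level n. *)
Lemma cone_poly_V_cone k : (mdeg k <= n)%N -> V_cone mu p n (f k n).
Proof.
move=> kn; split; first exact: (msize_cone_poly p P_basis kn).
move=> g gn; have gn' := leqW gn.
rewrite ip_cone_mean (cone_meanM_mlin (msize_cone_poly p P_basis kn) gn' (leqnn _) (leqnn _)).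
have nn : 2 * n%:R < p - 2 * al + 2 by move: np; lra.
elim: (cone_span P_basis nn gn) => [|c [k' m] u /= [k'm mn] _ IH].
  by rewrite mulr0 linear0.
rewrite mulrDr linearD /= IH addr0 -scalerAr linearZ /= mlin_cone_poly ?(ltnW mn)//.
by rewrite gtn_eqF// mulr0 mul0r scaler0.
Qed.

Lemma cone_poly_basis : is_basis predT
  (fun k : bmultinom d n.+1 => f k n) (V_cone mu p n).
Proof.
have fn (k : bmultinom d n.+1) : (mdeg k <= n)%N := ltnSE (bmdeg k).
split=> [k _|c c0 k _|v [vn vort]]; first exact: cone_poly_V_cone.
  have : L ((\sum_(i in predT) c i *: f i n) * f k n) = 0 by rewrite c0 mul0r linear0.
  rewrite mulr_suml linear_sum (bigD1 k)//= big1 ?addr0 => [|i ik].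
    rewrite -scalerAl linearZ /= mlin_cone_poly// !eqxx !mulr1.
    by move=> /eqP; rewrite mulf_eq0 => /orP[/eqP//|]; rewrite gt_eqF// H_const_gt0.
  rewrite -scalerAl linearZ /= mlin_cone_poly//.
  by move: ik; rewrite bmeqP => /negbTE ->; rewrite mulr0 scaler0.
exists (fun k : bmultinom d n.+1 => L (v * f k n) / H k n); rewrite -{1}(expansionE vn) /expansion.
rewrite big_ord_recr /= big1 ?add0r// => m _; apply: big1 => k _.
have km := ltnSE (bmdeg k); have mn := ltnW (ltn_ord m).
(* The coefficient is written with [L], the orthogonality of v with [ip_cone]; the two agree in
   these degrees. *)
rewrite -(cone_meanM_mlin vn (msize_cone_poly p P_basis km) (leqnn _) mn).
rewrite -ip_cone_mean vort ?mul0r ?scale0r//.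
exact: leq_trans (msize_cone_poly p P_basis km) (ltn_ord m).
Qed.

End ConeBasis.

Theorem proposition3p5 (R : realType) (d : nat) (mu p : R) (n n' : nat)
    (P : multinom d -> mpoly d R)
    (d_ge1 : (1 <= d)%N)
    (mu_gt : - 2^-1 < mu)
    (p_gt : 2 * (maxn n n')%:R + 2 * mu + d%:R < p)
    (P_basis : forall m : nat,
      orthonormal_basis (ip_ball mu)
        [pred k : bmultinom d m.+1 | mdeg k == m]
        (fun k : bmultinom d m.+1 => P k) (V_ball mu m)) :
  orthogonal_basis (ip_cone mu p) predT
    (fun k : bmultinom d n.+1 => cone_poly mu p P k n) (V_cone mu p n)
  /\
  forall (m m' : nat) (k k' : multinom d),
    mdeg k = m -> (m <= n)%N -> mdeg k' = m' -> (m' <= n')%N ->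
    ip_cone mu p (cone_poly mu p P k n) (cone_poly mu p P k' n') =
    H_const d mu p m n * (n == n')%:R * (m == m')%:R * (k == k')%:R.
Proof.
have d1 : 1 <= d%:R :> R by rewrite ler1n.
have N0 := ler0n R (maxn n n').
have alE : p - 2 * alpha d mu = p - 2 * mu - d%:R + 1 by rewrite /alpha; field.
have p0 : 0 < p by lra.
have nN : 2 * (maxn n n')%:R + 1 < p - 2 * alpha d mu by rewrite alE; lra.
have np : 2 * n%:R + 1 < p - 2 * alpha d mu.
  by have : n%:R <= (maxn n n')%:R :> R; [rewrite ler_nat leq_maxl|lra].
split.
  split; first exact: cone_poly_basis.
  move=> i j _ _ ij; rewrite ip_cone_mean cone_mean_cone_poly ?maxnn ?(ltnSE (bmdeg _))//.
  by move: ij; rewrite bmeqP => /negbTE ->; rewrite mulr0.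
move=> m m' k k' <- mn <- m'n; rewrite ip_cone_mean cone_mean_cone_poly//.
(* Equal indices have equal degrees, so the factor for m = m' is absorbed by the one for k = k'. *)
by have [->|_] := eqVneq k k'; [rewrite eqxx !mulr1|rewrite !mulr0].
Qed.
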